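(* Let $0<\beta<2$, $d\ge2$, and let $u_\varepsilon$ be as below. Define $v_\varepsilon(x_1,\dots,x_d):=u_\varepsilon(x_1)$. Then there exist constants $C_2,C_3>0$ independent of $\varepsilon$ such that \[\mathcal{L}v_\varepsilon(0)\ge\frac{C_2}{\varepsilon},\qquad 0<\Gamma_2(v_\varepsilon)(0)\le\frac{C_3}{\varepsilon}\] for all $\varepsilon>0$ small enough. In particular, for every $\mu>0$ there exists $v$ with $0<\Gamma_2(v)(0)<\mu(\mathcal{L}v(0))^2<\infty$.
   Context: $u_\varepsilon$: fix $\Lambda>0$, $\delta>0$ with $\beta+\delta>1$; for $0<\varepsilon<\beta/2$ (and $\varepsilon<\frac{\beta-1}{2}$ if $\beta>1$), $u_\varepsilon\in C^1(\mathbb{R})$ is even with $u_\varepsilon(x)=|x|^{\beta-\varepsilon}$ for $|x|\ge1$ and $u_\varepsilon(x)=\phi(x)$ for $|x|<1$, where $0\le\phi(x)\le\Lambda|x|^{\beta+\delta}$ and $|\phi'(x)|\le\Lambda|x|^{\beta+\delta-1}$ for $|x|\le1$. On $\mathbb{R}^d$: $c_{\beta,d}=\frac{2^\beta\Gamma(\frac{d+\beta}{2})}{\pi^{d/2}|\Gamma(-\frac{\beta}{2})|}$, $\mathcal{L}u(x)=c_{\beta,d}\int_{\mathbb{R}^d}\frac{u(x+h)-2u(x)+u(x-h)}{|h|^{d+\beta}}dh$, $\Gamma_2(u)(x)=c_{\beta,d}^2\int_{\mathbb{R}^d}\int_{\mathbb{R}^d}\frac{[u(x+h+\sigma)-u(x+h)-u(x+\sigma)+u(x)]^2}{|h|^{d+\beta}|\sigma|^{d+\beta}}dh\,d\sigma$.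 *)

(* Defs.v *)
From Stdlib Require Import Reals Lra List ClassicalEpsilon.
Open Scope R_scope.

(* |x|^a, with the convention |0|^a = 0 (all exponents used are > 0). *)
Definition apow (x a : R) : R :=
  if Req_EM_T x 0 then 0 else Rpower (Rabs x) a.

(* Points of R^d are functions nat -> R, only coordinates < d matter. *)
Fixpoint sumd (n : nat) (g : nat -> R) : R :=
  match n with O => 0 | S k => sumd k g + g k end.
Fixpoint prodd (n : nat) (g : nat -> R) : R :=
  match n with O => 1 | S k => prodd k g * g k end.

Definition normd (d : nat) (x : nat -> R) : R := sqrt (sumd d (fun i => x i ^ 2)).
Definition vadd (x y : nat -> R) : nat -> R := fun i => x i + y i.
Definition vsub (x y : nat -> R) : nat -> R := fun i => x i - y i.
Definition vzero : nat -> R := fun _ => 0.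
Definition trunc (d : nat) (x : nat -> R) : nat -> R :=
  fun i => if Nat.ltb i d then x i else 0.

Fixpoint box_ind (n : nat) (a b x : nat -> R) : R :=
  match n with
  | O => 1
  | S k => box_ind k a b x *
           (if Rle_dec (a k) (x k) then if Rle_dec (x k) (b k) then 1 else 0 else 0)
  end.
Definition box_vol (n : nat) (a b : nat -> R) : R := prodd n (fun i => b i - a i).

(* nonnegative step functions: finite lists of (coefficient, (a, b)) *)
Definition step := list (R * ((nat -> R) * (nat -> R))).
Definition step_ok (d : nat) (s : step) : Prop :=
  Forall (fun t => 0 <= fst t /\ forall i, (i < d)%nat -> fst (snd t) i <= snd (snd t) i) s.
Definition step_val (d : nat) (s : step) (x : nat -> R) : R :=
  fold_right (fun t acc => acc + fst t * box_ind d (fst (snd t)) (snd (snd t)) x) 0 s.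
Definition step_int (d : nat) (s : step) : R :=
  fold_right (fun t acc => acc + fst t * box_vol d (fst (snd t)) (snd (snd t))) 0 s.

Definition lower_set (d : nat) (f : (nat -> R) -> R) (r : R) : Prop :=
  exists s, step_ok d s /\ (forall x, step_val d s x <= f x) /\ r = step_int d s.

Definition nn_integral_is (d : nat) (f : (nat -> R) -> R) (I : R) : Prop :=
  is_lub (lower_set d f) I.

Definition integral_is (d : nat) (f : (nat -> R) -> R) (I : R) : Prop :=
  exists Ip Im,
    nn_integral_is d (fun x => Rmax (f x) 0) Ip /\
    nn_integral_is d (fun x => Rmax (- f x) 0) Im /\ I = Ip - Im.

Definition gamma_integrand (s : R) (t : nat -> R) : R :=
  if Rlt_dec 0 (t O) then Rpower (t O) (s - 1) * exp (- t O) else 0.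
Definition Gamma_pos (s : R) : R :=
  epsilon (inhabits 0) (fun I => nn_integral_is 1 (gamma_integrand s) I).
(* valid for s > 0 and, via Gamma(s) = Gamma(s+1)/s, for -1 < s < 0 *)
Definition Gamma (s : R) : R :=
  if Rlt_dec 0 s then Gamma_pos s else Gamma_pos (s + 1) / s.

Definition c_const (beta : R) (d : nat) : R :=
  Rpower 2 beta * Gamma ((INR d + beta) / 2) /
  (Rpower PI (INR d / 2) * Rabs (Gamma (- (beta / 2)))).

Definition L_is (beta : R) (d : nat) (u : (nat -> R) -> R) (x : nat -> R) (val : R) : Prop :=
  integral_is d
    (fun z => let h := trunc d z in
       c_const beta d * (u (vadd x h) - 2 * u x + u (vsub x h))
       / apow (normd d h) (INR d + beta))
    val.

(* Gamma_2(u)(x) = val ; the double integral over R^d x R^d is an integral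
   over R^(2d), z = (h, sigma) with h_i = z_i, sigma_i = z_(d+i). *)
Definition Gamma2_is (beta : R) (d : nat) (u : (nat -> R) -> R) (x : nat -> R) (val : R) : Prop :=
  integral_is (2 * d)
    (fun z => let h := trunc d z in
              let sg := trunc d (fun i => z (d + i)%nat) in
       (c_const beta d) ^ 2 *
       (u (vadd (vadd x h) sg) - u (vadd x h) - u (vadd x sg) + u x) ^ 2
       / (apow (normd d h) (INR d + beta) * apow (normd d sg) (INR d + beta)))
    val.

Definition admissible (beta eps : R) : Prop :=
  0 < eps < beta / 2 /\ (1 < beta -> eps < (beta - 1) / 2).

Definition u_profile (beta Lam delta eps : R) (w : R -> R) : Prop :=
  (exists w' : R -> R,
      (forall x, derivable_pt_lim w x (w' x)) /\ continuity w' /\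
      (forall x, Rabs x < 1 -> Rabs (w' x) <= Lam * apow x (beta + delta - 1))) /\
  (forall x, w (- x) = w x) /\
  (forall x, 1 <= Rabs x -> w x = apow x (beta - eps)) /\
  (forall x, Rabs x < 1 -> 0 <= w x <= Lam * apow x (beta + delta)).

Definition depends_on_first (d : nat) (v : (nat -> R) -> R) : Prop :=
  forall x y, (forall i, (i < d)%nat -> x i = y i) -> v x = v y.
Definition cont_Rd (d : nat) (v : (nat -> R) -> R) : Prop :=
  forall x eps, 0 < eps -> exists del, 0 < del /\
    forall y, normd d (vsub y x) < del -> Rabs (v y - v x) < eps.

(* Main.v *)
(** Every integrand is nonnegative, so its integral exists as soon as its lower sums are bounded. Slicing the lower sums bounds them one coordinate at a time, and a one-dimensional lower sum is compared with an antiderivative by the mean value theorem. Integrating out the transversal coordinates turns [|h|^(-d-beta)] into a multiple of [|h_1|^(-1-beta)], using [|h|^(d+beta) >= prod_(i >= 2) max(|h_1|, |h_i|)^(1+k)] with [k = (1+beta)/(d-1)].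

For [Gamma_2], with [m <= M] the absolute values of the two arguments and [beta/2 < s < min(1, beta)], the second difference of [u_eps] is [O(m^s M^(r-s))] for every [r] in [[beta-eps, beta+delta]], uniformly in [eps]. As [2s > beta], the inner integral is [O(|h_1|^(2r-beta))]; taking [r = beta + delta'] near the origin and [r = beta - eps] at infinity leaves [\int_1^oo t^(-1-2eps) dt], which is the only source of [1/eps]. The lower bound for [L] sums over [1/eps] disjoint dyadic cubes, each contributing a fixed amount. *)
Require Import Defs.
From Stdlib Require Import Reals Lra Lia List ZArith ClassicalEpsilon.
Open Scope R_scope.

(** Since an integral is a supremum of lower sums, the two directions differ in nature. An upper
    bound concerns every step function below the integrand, and slicing yields exactly the
    inequality needed, without measurability or exchange of limits. A lower bound asks for one
    explicit step function, which also gives [0 < G]. Why [s] lies strictly between [beta / 2] and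
    [beta]: the inner integral in the first coordinate of [sigma] converges at 0 if [2 s > beta],
    and at infinity if [beta + 2 s > 2 r], which for [r] near [beta] is again [2 s > beta]. On the
    other hand [s <= r] must hold for the smallest exponent [r = beta - eps], so [eps] has to stay
    below [beta - s]. Positivity of [Gamma_2] could fail only if the power at infinity were linear,
    because the second difference of a linear function vanishes; [admissible] keeps [beta - eps]
    different from 1. The final claim also requires that some family of profiles exists, so one is
    built. *)

Definition lint_le (n : nat) (f : (nat -> R) -> R) (C : R) : Prop :=
  forall s, step_ok n s -> (forall x, step_val n s x <= f x) -> step_int n s <= C.

(** * Lower sums on the line and their primitives *)

Definition seg_ind (a b t : R) : R :=
  if Rle_dec a t then if Rle_dec t b then 1 else 0 else 0.
(** For [a <= b] this is, up to a constant, the primitive of [seg_ind a b]; hence [segs_prim] is a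
    primitive of [segs_val] away from the endpoints. *)
Definition clamp (a b t : R) : R := Rmax a (Rmin t b).

Definition segs := list (R * (R * R)).
Definition segs_ok (l : segs) : Prop :=
  Forall (fun p => 0 <= fst p /\ fst (snd p) <= snd (snd p)) l.
Definition segs_val (l : segs) (t : R) : R :=
  fold_right (fun p acc => acc + fst p * seg_ind (fst (snd p)) (snd (snd p)) t) 0 l.
Definition segs_int (l : segs) : R :=
  fold_right (fun p acc => acc + fst p * (snd (snd p) - fst (snd p))) 0 l.
Definition segs_prim (l : segs) (t : R) : R :=
  fold_right (fun p acc => acc + fst p * clamp (fst (snd p)) (snd (snd p)) t) 0 l.

Definition lint1_le (g : R -> R) (C : R) : Prop :=
  forall l, segs_ok l -> (forall t, segs_val l t <= g t) -> segs_int l <= C.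
(* The part of the lower integral carried by [A, B]. *)
Definition lint1_on (g : R -> R) (A B C : R) : Prop :=
  forall l, segs_ok l -> (forall t, segs_val l t <= g t) ->
    segs_prim l B - segs_prim l A <= C.

Lemma clamp_no_endpoint a b x y c :
  a <= b -> x < c < y -> ~ x < a < y -> ~ x < b < y ->
  clamp a b y - clamp a b x = seg_ind a b c * (y - x).
Proof.
  intros Hab Hc Ha Hb. unfold clamp, seg_ind, Rmax, Rmin.
  repeat (destruct Rle_dec); try lra;
  (exfalso; destruct (Rlt_dec x a); destruct (Rlt_dec a y); destruct (Rlt_dec x b);
   destruct (Rlt_dec b y); try lra; tauto).
Qed.

Definition endpoints (l : segs) : list R :=
  flat_map (fun p => fst (snd p) :: snd (snd p) :: nil) l.

Lemma segs_prim_no_endpoint l x y c :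
  segs_ok l -> x < c < y -> (forall e, In e (endpoints l) -> ~ x < e < y) ->
  segs_prim l y - segs_prim l x = segs_val l c * (y - x).
Proof.
  intros Hl Hc He. induction Hl as [|[k [a b]] l [_ Hab] Hl IH]; simpl in *; [lra|].
  rewrite Rmult_plus_distr_r, <- IH by (intros; apply He; tauto).
  rewrite Rmult_assoc, <- (clamp_no_endpoint a b x y c); auto. ring.
Qed.

(** Induction on a list [pts] of possible breakpoints: an entry inside the interval cuts it in two,
    any other entry is dropped. Once no endpoint lies inside, the step function is constant there,
    so it can be evaluated at the very point that the mean value theorem supplies. *)
Lemma segs_prim_mvt (F F' g : R -> R) l pts x y :
  segs_ok l -> (forall t, segs_val l t <= g t) -> x <= y ->
  (forall t, x <= t <= y -> derivable_pt_lim F t (F' t)) ->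
  (forall t, x < t < y -> g t <= F' t) ->
  (forall e, In e (endpoints l) -> x < e < y -> In e pts) ->
  segs_prim l y - segs_prim l x <= F y - F x.
Proof.
  intros Hl Hg. revert x y. induction pts as [|p pts IH]; intros x y Hxy HF Hle He.
  - destruct Hxy as [Hxy| ->]; [|lra].
    destruct (MVT_cor2 F F' x y Hxy HF) as [c [-> Hc]].
    rewrite (segs_prim_no_endpoint l x y c Hl Hc (fun e H1 H2 => He e H1 H2)).
    apply Rmult_le_compat_r; [lra|].
    apply Rle_trans with (g c); auto.
  - destruct (Rlt_dec x p) as [Hxp|Hxp]; [destruct (Rlt_dec p y) as [Hpy|Hpy]|].
    + assert (segs_prim l p - segs_prim l x <= F p - F x).
      { apply IH; [lra|intros; apply HF; lra|intros; apply Hle; lra|].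
        intros e H1 H2. destruct (He e H1); [lra|lra|auto]. }
      assert (segs_prim l y - segs_prim l p <= F y - F p).
      { apply IH; [lra|intros; apply HF; lra|intros; apply Hle; lra|].
        intros e H1 H2. destruct (He e H1); [lra|lra|auto]. }
      lra.
    + apply IH; auto. intros e H1 H2. destruct (He e H1); [lra|lra|auto].
    + apply IH; auto. intros e H1 H2. destruct (He e H1); [lra|lra|auto].
Qed.

Lemma lint1_on_antideriv (F F' g : R -> R) x y :
  x <= y -> (forall t, x <= t <= y -> derivable_pt_lim F t (F' t)) ->
  (forall t, x < t < y -> g t <= F' t) -> lint1_on g x y (F y - F x).
Proof.
  intros Hxy HF Hle l Hl Hg.
  apply (segs_prim_mvt F F' g l (endpoints l)); auto.
Qed.

Lemma clamp_incr a b x y : x <= y -> 0 <= clamp a b y - clamp a b x <= y - x.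
Proof.
  intros; unfold clamp, Rmax, Rmin; repeat destruct Rle_dec; lra.
Qed.

Lemma segs_prim_lipschitz l : segs_ok l ->
  exists K, 0 <= K /\ forall x y, x <= y -> segs_prim l y - segs_prim l x <= K * (y - x).
Proof.
  induction 1 as [|[k [a b]] l [Hk Hab] Hl [K [HK IH]]]; simpl in *.
  - exists 0; split; [lra|]; intros; lra.
  - exists (K + k); split; [lra|]. intros x y Hxy. specialize (IH x y Hxy).
    assert (H := clamp_incr a b x y Hxy).
    assert (k * (clamp a b y - clamp a b x) <= k * (y - x))
      by (apply Rmult_le_compat_l; lra).
    nra.
Qed.

Lemma Rle_of_eps_mult a b K r :
  0 < r -> 0 <= K -> (forall e, 0 < e <= r -> a <= b + K * e) -> a <= b.
Proof.
  intros Hr HK H. apply Rnot_lt_le; intro Hlt.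
  set (e := Rmin r ((a - b) / (2 * (K + 1)))).
  assert (He0 : 0 < (a - b) / (2 * (K + 1))) by (apply Rdiv_lt_0_compat; lra).
  assert (He : 0 < e <= r).
  { unfold e; split; [apply Rmin_glb_lt; lra|apply Rmin_l]. }
  assert (He2 : e <= (a - b) / (2 * (K + 1))) by apply Rmin_r.
  assert (K * e <= (a - b) / 2).
  { apply Rle_trans with ((K + 1) * ((a - b) / (2 * (K + 1)))).
    - apply Rmult_le_compat; lra.
    - right; field; lra. }
  specialize (H e He). lra.
Qed.

(* The primitive of a step function is Lipschitz, so an integrable singularity at the left end may be cut off. *)
Lemma lint1_on_shrink_left g x y C :
  x < y -> (forall e, 0 < e < y - x -> lint1_on g (x + e) y C) -> lint1_on g x y C.
Proof.
  intros Hxy H l Hl Hg.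
  destruct (segs_prim_lipschitz l Hl) as [K [HK HL]].
  apply (Rle_of_eps_mult _ _ K ((y - x) / 2)); [lra|lra|].
  intros e He. specialize (H e ltac:(lra) l Hl Hg). specialize (HL x (x + e) ltac:(lra)).
  replace (x + e - x) with e in HL by ring. lra.
Qed.

Lemma lint1_on_chasles g x y z C D :
  lint1_on g x y C -> lint1_on g y z D -> lint1_on g x z (C + D).
Proof.
  intros H1 H2 l Hl Hg. specialize (H1 l Hl Hg). specialize (H2 l Hl Hg). lra.
Qed.

Definition segs_opp (l : segs) : segs :=
  map (fun p => (fst p, (- snd (snd p), - fst (snd p)))) l.

Lemma segs_opp_val l t : segs_val (segs_opp l) t = segs_val l (- t).
Proof.
  induction l as [|[k [a b]] l IH]; simpl; [easy|]. rewrite IH. f_equal. f_equal.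
  unfold seg_ind. repeat destruct Rle_dec; lra.
Qed.

Lemma segs_opp_prim l t : segs_ok l -> segs_prim (segs_opp l) t = - segs_prim l (- t).
Proof.
  induction 1 as [|[k [a b]] l [_ Hab] Hl IH]; simpl in *; [lra|].
  rewrite IH, Ropp_plus_distr. f_equal. rewrite <- Ropp_mult_distr_r_reverse. f_equal.
  unfold clamp, Rmax, Rmin. repeat destruct Rle_dec; lra.
Qed.

Lemma lint1_on_opp g x y C :
  lint1_on (fun t => g (- t)) x y C -> lint1_on g (- y) (- x) C.
Proof.
  intros H l Hl Hg.
  assert (H1 := H (segs_opp l)). rewrite !segs_opp_prim in H1 by auto.
  assert (segs_ok (segs_opp l)).
  { unfold segs_ok, segs_opp. rewrite Forall_map.
    eapply Forall_impl; [|exact Hl]. simpl. intros; lra. }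
  specialize (H1 H0). lapply H1; [lra|].
  intros t. rewrite segs_opp_val. auto.
Qed.

Lemma segs_prim_outside l : segs_ok l ->
  exists N, forall x, N <= x -> segs_prim l x - segs_prim l (- x) = segs_int l.
Proof.
  induction 1 as [|[k [a b]] l [_ Hab] Hl [N IH]]; simpl in *.
  - exists 0; intros; lra.
  - exists (Rmax N (Rmax (Rabs a) (Rabs b))). intros x Hx.
    assert (N <= x) by (eapply Rle_trans; [apply Rmax_l|exact Hx]).
    assert (Rabs a <= x) by (eapply Rle_trans; [|exact Hx]; rewrite <- Rmax_r; apply Rmax_l).
    assert (Rabs b <= x) by (eapply Rle_trans; [|exact Hx]; rewrite <- Rmax_r; apply Rmax_r).
    rewrite <- (IH x) by auto.
    assert (clamp a b x = b /\ clamp a b (- x) = a) as [-> ->].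
    { unfold clamp, Rabs, Rmax, Rmin in *. repeat destruct Rcase_abs; repeat destruct Rle_dec; lra. }
    ring.
Qed.

(** A step function has bounded support, so bounds on [[-N, N]] that do not depend on [N]
    suffice. *)
Lemma lint1_exhaust g C N0 :
  (forall N, N0 < N -> lint1_on g (- N) N C) -> lint1_le g C.
Proof.
  intros H l Hl Hg. destruct (segs_prim_outside l Hl) as [N HN].
  set (M := Rmax N (N0 + 1)).
  assert (N <= M) by apply Rmax_l. assert (N0 + 1 <= M) by apply Rmax_r.
  rewrite <- (HN M) by auto. apply H; auto; lra.
Qed.

(** * Integrals of powers over the line *)

Lemma Rpower_pos x y : 0 < Rpower x y.
Proof. apply exp_pos. Qed.

Lemma Rpower_antideriv A a t : a <> 0 -> 0 < t ->
  derivable_pt_lim (fun t => A * Rpower t a / a) t (A * Rpower t (a - 1)).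
Proof.
  intros Ha Ht.
  replace (A * Rpower t (a - 1)) with (A / a * (a * Rpower t (a - 1))) by (field; auto).
  assert (H := derivable_pt_lim_scal _ (A / a) _ _ (derivable_pt_lim_power t a Ht)).
  intros e He. destruct (H e He) as [dl Hd]. exists dl. intros h Hh Hh'.
  specialize (Hd h Hh Hh'). unfold mult_real_fct in Hd.
  replace (A * Rpower (t + h) a / a) with (A / a * Rpower (t + h) a) by (field; auto).
  replace (A * Rpower t a / a) with (A / a * Rpower t a) by (field; auto).
  exact Hd.
Qed.

Lemma lint1_on_power_half (g : R -> R) A a B b rho N :
  0 < a -> 0 < b -> 0 < rho < N -> 0 <= A -> 0 <= B ->
  (forall t, 0 < t < rho -> g t <= A * Rpower t (a - 1)) ->
  (forall t, rho < t -> g t <= B * Rpower t (- b - 1)) ->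
  lint1_on g 0 N (A * Rpower rho a / a + B * Rpower rho (- b) / b).
Proof.
  intros Ha Hb HN HA HB H1 H2.
  apply lint1_on_chasles with rho.
  - apply lint1_on_shrink_left; [lra|]. intros e He. rewrite Rplus_0_l.
    intros l Hl Hg.
    apply Rle_trans with (A * Rpower rho a / a - A * Rpower e a / a).
    + refine (lint1_on_antideriv (fun t => A * Rpower t a / a)
                (fun t => A * Rpower t (a - 1)) g e rho _ _ _ l Hl Hg); [lra| |].
      * intros; apply Rpower_antideriv; lra.
      * intros; apply H1; lra.
    + assert (0 <= A * Rpower e a / a); [|lra].
      apply Rle_mult_inv_pos; auto. apply Rmult_le_pos; auto. left; apply Rpower_pos.
  - intros l Hl Hg.
    apply Rle_trans with (B * Rpower N (- b) / (- b) - B * Rpower rho (- b) / (- b)).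
    + refine (lint1_on_antideriv (fun t => B * Rpower t (- b) / (- b))
                (fun t => B * Rpower t (- b - 1)) g rho N _ _ _ l Hl Hg); [lra| |].
      * intros; apply Rpower_antideriv; lra.
      * intros; apply H2; lra.
    + assert (0 <= B * Rpower N (- b) / b).
      { apply Rle_mult_inv_pos; auto. apply Rmult_le_pos; auto. left; apply Rpower_pos. }
      replace (B * Rpower N (- b) / (- b)) with (- (B * Rpower N (- b) / b)) by (field; lra).
      replace (B * Rpower rho (- b) / (- b)) with (- (B * Rpower rho (- b) / b)) by (field; lra).
      lra.
Qed.

(** Every one-dimensional upper bound below comes from this one: a power integrable at the origin,
    another integrable at infinity. Nothing is asked of [g] at [0] and at distance [rho], so
    functions defined by cases need no care there. *)
Lemma lint1_le_power (g : R -> R) A a B b rho :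
  0 < a -> 0 < b -> 0 < rho -> 0 <= A -> 0 <= B ->
  (forall t, 0 < Rabs t < rho -> g t <= A * Rpower (Rabs t) (a - 1)) ->
  (forall t, rho < Rabs t -> g t <= B * Rpower (Rabs t) (- b - 1)) ->
  lint1_le g (2 * (A * Rpower rho a / a + B * Rpower rho (- b) / b)).
Proof.
  intros Ha Hb Hr HA HB H1 H2. apply lint1_exhaust with rho. intros N HN.
  rewrite <- Rplus_diag. apply lint1_on_chasles with 0.
  - rewrite <- Ropp_0. apply lint1_on_opp. apply lint1_on_power_half; auto; intros t Ht;
      assert (E : Rabs (- t) = t) by (rewrite Rabs_Ropp, Rabs_pos_eq; lra);
      [specialize (H1 (- t))|specialize (H2 (- t))]; rewrite E in *; auto.
  - apply lint1_on_power_half; auto; intros t Ht;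
      assert (E : Rabs t = t) by (rewrite Rabs_pos_eq; lra);
      [specialize (H1 t)|specialize (H2 t)]; rewrite E in *; auto.
Qed.

(** * Slicing lower sums on boxes *)

Definition upd (x : nat -> R) (n : nat) (t : R) : nat -> R :=
  fun i => if Nat.eqb i n then t else x i.

Lemma upd_eq x n t : upd x n t n = t.
Proof. unfold upd. now rewrite Nat.eqb_refl. Qed.

Lemma upd_neq x n t i : i <> n -> upd x n t i = x i.
Proof. intros H. unfold upd. apply Nat.eqb_neq in H. now rewrite H. Qed.

Lemma box_ind_ext n a b x y :
  (forall i, (i < n)%nat -> x i = y i) -> box_ind n a b x = box_ind n a b y.
Proof.
  intros H. induction n as [|n IH]; simpl; auto.
  rewrite IH, (H n) by auto. reflexivity.
Qed.

Lemma box_ind_nonneg n a b x : 0 <= box_ind n a b x.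
Proof.
  induction n as [|n IH]; simpl; [lra|]. repeat destruct Rle_dec; lra.
Qed.

(** Multiplying each coefficient by the length of its last side turns a step function below [f] into
    one in [n] variables with the same integral. Its value at [x] is the integral of the slice
    through [x], hence at most [g x]; so it lies below [g]. *)
Lemma lint_le_fubini n f g C :
  (forall x, lint1_le (fun t => f (upd x n t)) (g x)) -> lint_le n g C -> lint_le (S n) f C.
Proof.
  intros Hsl Hg s Hs Hle.
  set (s' := map (fun t => (fst t * (snd (snd t) n - fst (snd t) n), snd t)) s).
  replace (step_int (S n) s) with (step_int n s').
  2:{ unfold s'; clear. induction s as [|[k [a b]] s IH]; [easy|]; simpl in *.
      rewrite IH. unfold box_vol; simpl; ring. }
  apply Hg.
  - unfold step_ok, s'. rewrite Forall_map. eapply Forall_impl; [|exact Hs].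
    intros [k [a b]] [Hk Hab]; simpl in *. split; [|intros; apply Hab; lia].
    apply Rmult_le_pos; auto. specialize (Hab n ltac:(lia)). lra.
  - intros x.
    set (l := map (fun t => (fst t * box_ind n (fst (snd t)) (snd (snd t)) x,
                             (fst (snd t) n, snd (snd t) n))) s).
    replace (step_val n s' x) with (segs_int l).
    2:{ unfold s', l; clear. induction s as [|[k [a b]] s IH]; [easy|]; simpl in *.
        rewrite IH; ring. }
    apply Hsl.
    + unfold segs_ok, l. rewrite Forall_map. eapply Forall_impl; [|exact Hs].
      intros [k [a b]] [Hk Hab]; simpl in *. split; [|apply Hab; lia].
      apply Rmult_le_pos; auto. apply box_ind_nonneg.
    + intros t. eapply Rle_trans; [|apply Hle]. right.
      unfold l; clear. induction s as [|[k [a b]] s IH]; [easy|]; simpl in *.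
      rewrite IH, upd_eq. unfold seg_ind.
      rewrite (box_ind_ext n a b (upd x n t) x) by (intros; apply upd_neq; lia). ring.
Qed.

Lemma lint_le_0 f x C : f x <= C -> lint_le 0 f C.
Proof.
  intros H s _ Hs. eapply Rle_trans; [|exact H]. eapply Rle_trans; [|apply Hs].
  right. clear. induction s as [|[k [a b]] s IH]; [easy|]; simpl in *.
  rewrite IH. reflexivity.
Qed.

Lemma lint_le_mono n f g C D :
  (forall x, f x <= g x) -> C <= D -> lint_le n g C -> lint_le n f D.
Proof.
  intros H HC Hg s Hs Hle. apply Rle_trans with C; auto. apply Hg; auto.
  intros x. eapply Rle_trans; [apply Hle|apply H].
Qed.

Lemma lint1_le_mono f g C D :
  (forall x, f x <= g x) -> C <= D -> lint1_le g C -> lint1_le f D.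
Proof.
  intros H HC Hg s Hs Hle. apply Rle_trans with C; auto. apply Hg; auto.
  intros x. eapply Rle_trans; [apply Hle|apply H].
Qed.

Lemma lint_le_dim1 f g C :
  (forall x, f x <= g (x O)) -> lint1_le g C -> lint_le 1 f C.
Proof.
  intros H Hg. apply lint_le_fubini with (fun _ => C).
  - intros x. eapply lint1_le_mono; [|apply Rle_refl|exact Hg].
    intros t. eapply Rle_trans; [apply H|]. rewrite upd_eq. lra.
  - apply (lint_le_0 _ (fun _ => 0)). lra.
Qed.

(** * Existence of integrals of nonnegative functions *)

Lemma nn_integral_is_ext n f g I :
  (forall x, f x = g x) -> nn_integral_is n f I -> nn_integral_is n g I.
Proof.
  intros H [Hu Hl]. split.
  - intros r [s [Hs [Hv ->]]]. apply Hu. exists s. repeat split; auto.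
    intros x. rewrite H. auto.
  - intros b Hb. apply Hl. intros r [s [Hs [Hv ->]]]. apply Hb. exists s. repeat split; auto.
    intros x. rewrite <- H. auto.
Qed.

Lemma integral_is_ext n f g I : (forall x, f x = g x) -> integral_is n f I -> integral_is n g I.
Proof.
  intros H [Ip [Im [H1 [H2 H3]]]]. exists Ip, Im. split; [|split; auto].
  - revert H1. apply nn_integral_is_ext. intros x. now rewrite H.
  - revert H2. apply nn_integral_is_ext. intros x. now rewrite H.
Qed.

Lemma nn_integral_exists n f C :
  lint_le n f C -> (forall x, 0 <= f x) ->
  exists I, nn_integral_is n f I /\ I <= C.
Proof.
  intros H Hf.
  assert (Hub : is_upper_bound (lower_set n f) C).
  { intros r [s [Hs [Hv ->]]]. now apply H. }
  destruct (completeness (lower_set n f)) as [I HI].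
  - now exists C.
  - exists 0, nil. repeat split; [constructor|exact Hf].
  - exists I. split; [exact HI|]. now apply HI.
Qed.

Lemma lint1_le_0 g : (forall t, g t <= 0) -> lint1_le g 0.
Proof.
  intros Hg.
  replace 0 with (2 * (0 * Rpower 1 1 / 1 + 0 * Rpower 1 (- (1)) / 1)) by field.
  apply lint1_le_power; try lra; intros; rewrite Rmult_0_l; apply Hg.
Qed.

Lemma lint_le_zero_fun n : lint_le n (fun _ => 0) 0.
Proof.
  induction n as [|n IH].
  - apply (lint_le_0 _ (fun _ => 0)). lra.
  - apply lint_le_fubini with (fun _ => 0); auto. intros _. apply lint1_le_0. intros; lra.
Qed.

(** The value is returned also as a supremum of lower sums, so that a single step function can later
    bound it from below. *)
Lemma integral_exists n f C :
  lint_le n f C -> (forall x, 0 <= f x) ->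
  exists I, integral_is n f I /\ nn_integral_is n f I /\ I <= C.
Proof.
  intros H Hf. destruct (nn_integral_exists n f C H Hf) as [I [HI HIC]].
  exists I. split; auto. exists I, 0. split; [|split; [|lra]].
  - revert HI. apply nn_integral_is_ext. intros x. now rewrite Rmax_left.
  - apply nn_integral_is_ext with (fun _ => 0).
    + intros x. rewrite Rmax_right; auto. specialize (Hf x); lra.
    + split.
      * intros r [s [Hs [Hv ->]]]. now apply (lint_le_zero_fun n s).
      * intros b Hb. apply Hb. exists nil. repeat split; [constructor|]. simpl. intros; lra.
Qed.

(** * Positivity of the Gamma function and of the constant *)

Lemma exp_le_compat x y : x <= y -> exp x <= exp y.
Proof. intros [H| ->]; [left; now apply exp_increasing|apply Rle_refl]. Qed.

Lemma Rpower_1_l a : Rpower 1 a = 1.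
Proof. unfold Rpower. now rewrite ln_1, Rmult_0_r, exp_0. Qed.

Lemma ln_le_sub_1 x : 0 < x -> ln x <= x - 1.
Proof.
  intros Hx. assert (H := exp_ineq1_le (ln x)). rewrite exp_ln in H by auto. lra.
Qed.

Lemma gamma_integrand_lint s : 0 < s -> exists C, lint_le 1 (gamma_integrand s) C.
Proof.
  intros Hs.
  set (g := fun t => if Rlt_dec 0 t then Rpower t (s - 1) * exp (- t) else 0).
  (* [B] is the maximum of [t^(s+1) exp (- t)], attained at [t = s + 1]; thus the integrand is at
     most [B t^(-2)]. *)
  set (B := exp ((s + 1) * (ln (s + 1) - 1))).
  eexists. apply lint_le_dim1 with g; [intros x; apply Rle_refl|].
  apply (lint1_le_power g 1 s B 1 1); try lra.
  - left; apply exp_pos.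
  - intros t Ht. unfold g. destruct Rlt_dec as [H|H].
    + rewrite Rabs_pos_eq, Rmult_1_l by lra.
      rewrite <- Rmult_1_r. apply Rmult_le_compat_l; [left; apply exp_pos|].
      rewrite <- exp_0. apply exp_le_compat. lra.
    + rewrite Rmult_1_l. left; apply exp_pos.
  - intros t Ht. unfold g. destruct Rlt_dec as [H|H].
    + rewrite Rabs_pos_eq in * by lra. unfold B, Rpower. rewrite <- !exp_plus. apply exp_le_compat.
      assert (H1 : ln (t / (s + 1)) <= t / (s + 1) - 1)
        by (apply ln_le_sub_1, Rdiv_lt_0_compat; lra).
      unfold Rdiv in H1 at 1. rewrite ln_mult, ln_Rinv in H1 by (try apply Rinv_0_lt_compat; lra).
      assert (H2 : (s + 1) * (ln t) <= (s + 1) * (ln (s + 1) + (t / (s + 1) - 1)))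
        by (apply Rmult_le_compat_l; lra).
      replace ((s + 1) * (ln (s + 1) + (t / (s + 1) - 1)))
        with ((s + 1) * (ln (s + 1) - 1) + t) in H2 by (field; lra). lra.
    + apply Rmult_le_pos; left; apply exp_pos.
Qed.

(** [Gamma_pos] is obtained by choice, so nothing is known about it until the integral is shown to
    exist; one box then bounds it from below. *)
Lemma Gamma_pos_gt0 s : 0 < s -> 0 < Gamma_pos s.
Proof.
  intros Hs. destruct (gamma_integrand_lint s Hs) as [C HC].
  assert (Hpos : forall x, 0 <= gamma_integrand s x).
  { intros x. unfold gamma_integrand. destruct Rlt_dec; [|lra].
    apply Rmult_le_pos; left; apply exp_pos. }
  destruct (nn_integral_exists _ _ _ HC Hpos) as [I [HI _]].
  unfold Gamma_pos.
  assert (H := epsilon_spec (inhabits 0) (fun I => nn_integral_is 1 (gamma_integrand s) I)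
           (ex_intro _ I HI)).
  (* On [[1, 2]] the exponent [(s - 1) ln t - t] is at least [- ln t - t >= 1 - 2 t >= - 3]. *)
  cbv beta in H. apply Rlt_le_trans with (exp (- 3)); [apply exp_pos|].
  apply H. exists ((exp (- 3), (fun _ => 1, fun _ => 2)) :: nil). split; [|split].
  - constructor; [|constructor]. simpl. split; [left; apply exp_pos|intros; lra].
  - intros x. simpl. unfold gamma_integrand.
    destruct (Rle_dec 1 (x O)); [destruct (Rle_dec (x O) 2)|].
    + destruct Rlt_dec; [|lra]. unfold Rpower. rewrite <- exp_plus.
      rewrite Rplus_0_l, !Rmult_1_r. apply exp_le_compat.
      assert (ln (x O) <= x O - 1) by (apply ln_le_sub_1; lra).
      assert (0 <= ln (x O)) by (rewrite <- ln_1; destruct (Req_dec (x O) 1) as [->|]; [lra|left; apply ln_increasing; lra]).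
      assert (0 <= s * ln (x O)) by (apply Rmult_le_pos; lra). lra.
    + rewrite !Rmult_0_r, Rplus_0_l. apply Hpos.
    + rewrite !Rmult_0_r, Rplus_0_l. apply Hpos.
  - simpl. unfold box_vol. simpl. ring.
Qed.

(** As [- beta / 2] lies in [(-1, 0)], the denominator falls in the branch of [Gamma] given by the
    functional equation. *)
Lemma c_const_pos beta d : 0 < beta < 2 -> 0 < c_const beta d.
Proof.
  intros Hb. unfold c_const, Gamma.
  assert (0 <= INR d) by apply pos_INR.
  destruct (Rlt_dec 0 ((INR d + beta) / 2)) as [H1|H1]; [|lra].
  destruct (Rlt_dec 0 (- (beta / 2))) as [H2|H2]; [lra|].
  assert (0 < Gamma_pos ((INR d + beta) / 2)) by now apply Gamma_pos_gt0.
  assert (0 < Gamma_pos (- (beta / 2) + 1)) by (apply Gamma_pos_gt0; lra).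
  apply Rdiv_lt_0_compat; apply Rmult_lt_0_compat; auto; try apply Rpower_pos.
  apply Rabs_pos_lt. unfold Rdiv. apply Rmult_integral_contrapositive_currified; [lra|].
  apply Rinv_neq_0_compat. lra.
Qed.

(** * Integrating out the transversal coordinates *)

Definition maxpow (k y t : R) : R := Rpower (Rmax (Rabs y) (Rabs t)) (- k - 1).

(** The function is constant for [|t| < |y|], which contributes [2 |y|^(-k)]; the tail beyond
    contributes [(2 / k) |y|^(-k)]. *)
Lemma maxpow_lint K k y : 0 <= K -> 0 < k -> y <> 0 ->
  lint1_le (fun t => K * maxpow k y t) (K * (2 * (1 + / k) * Rpower (Rabs y) (- k))).
Proof.
  intros HK Hk Hy. assert (Hy' := Rabs_pos_lt y Hy).
  eapply lint1_le_mono;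
    [intros; apply Rle_refl| |
     apply (lint1_le_power _ (K * Rpower (Rabs y) (- k - 1)) 1 K k (Rabs y))]; auto; try lra.
  - assert (E : Rpower (Rabs y) (- k) = Rpower (Rabs y) (- k - 1) * Rabs y).
    { rewrite <- (Rpower_1 (Rabs y)) at 3 by auto. rewrite <- Rpower_plus. f_equal. ring. }
    right. rewrite Rpower_1, E by auto. field. lra.
  - apply Rmult_le_pos; auto. left; apply Rpower_pos.
  - intros t Ht. unfold maxpow. rewrite Rmax_left by lra.
    replace (1 - 1) with 0 by ring. rewrite Rpower_O by lra. lra.
  - intros t Ht. unfold maxpow. rewrite Rmax_right by lra. lra.
Qed.

(* Integrates out the coordinates o+1, ..., o+m, on which the integrand depends only through [maxpow]. *)
Lemma lint_le_transversal k o m (g : (nat -> R) -> R) C : 0 < k ->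
  (forall z, 0 <= g z) -> (forall z i t, (o < i)%nat -> g (upd z i t) = g z) ->
  (forall z, z o = 0 -> g z = 0) ->
  lint_le (S o) (fun z => g z * (2 * (1 + / k) * Rpower (Rabs (z o)) (- k)) ^ m) C ->
  lint_le (S o + m) (fun z => g z * prodd m (fun i => maxpow k (z o) (z (o + S i)%nat))) C.
Proof.
  intros Hk. revert g. induction m as [|m IH]; intros g Hg Hgi Hg0 H.
  - rewrite Nat.add_0_r. exact H.
  - assert (Hk' : 0 < / k) by now apply Rinv_0_lt_compat.
    assert (Hp : forall z : nat -> R, 0 <= prodd m (fun i => maxpow k (z o) (z (o + S i)%nat))).
    { clear. induction m as [|m IH]; intros; simpl; [lra|].
      apply Rmult_le_pos; auto. left; apply Rpower_pos. }
    rewrite Nat.add_succ_r.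
    apply lint_le_fubini with
      (fun z => (g z * (2 * (1 + / k) * Rpower (Rabs (z o)) (- k))) *
                prodd m (fun i => maxpow k (z o) (z (o + S i)%nat))).
    + intros z. destruct (Req_dec (z o) 0) as [H0|H0].
      * rewrite Hg0, !Rmult_0_l by auto. apply lint1_le_0. intros t.
        rewrite Hgi, Hg0 by (auto; lia). lra.
      * eapply lint1_le_mono; [| |apply (maxpow_lint
          (g z * prodd m (fun i => maxpow k (z o) (z (o + S i)%nat))) k (z o))]; auto.
        -- intros t. right. rewrite Hgi by lia. simpl.
           rewrite (upd_neq _ _ _ o) by lia.
           replace (o + S m)%nat with (S (o + m)) by lia. rewrite upd_eq.
           rewrite <- Rmult_assoc. f_equal. f_equal.
           assert (E : forall j, (j <= m)%nat ->
             prodd j (fun i => maxpow k (z o) (upd z (S (o + m)) t (o + S i)%nat)) =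
             prodd j (fun i => maxpow k (z o) (z (o + S i)%nat))).
           { induction j as [|j IHj]; simpl; auto. intros Hj. rewrite IHj, upd_neq by lia. auto. }
           apply E; lia.
        -- right; ring.
        -- apply Rmult_le_pos; auto.
    + apply (IH (fun z => g z * (2 * (1 + / k) * Rpower (Rabs (z o)) (- k)))).
      * intros z. apply Rmult_le_pos; auto. apply Rmult_le_pos; [lra|left; apply Rpower_pos].
      * intros z i t Hi. rewrite Hgi, upd_neq by (auto; lia). auto.
      * intros z Hz. rewrite Hg0 by auto. ring.
      * eapply lint_le_mono; [|apply Rle_refl|exact H]. intros z. simpl. right; ring.
Qed.

Lemma sumd_sq_ge n (x : nat -> R) i : (i < n)%nat -> x i ^ 2 <= sumd n (fun i => x i ^ 2).
Proof.
  induction n as [|n IH]; intros Hi; [lia|]. cbn [sumd].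
  assert (0 <= sumd n (fun i => x i ^ 2)).
  { clear. induction n as [|n IH]; cbn [sumd]; [lra|]. assert (H := pow2_ge_0 (x n)); lra. }
  assert (H1 := pow2_ge_0 (x n)).
  destruct (Nat.eq_dec i n) as [->|]; [lra|]. assert (x i ^ 2 <= sumd n (fun i => x i ^ 2)); [|lra].
  apply IH; lia.
Qed.

Lemma Rabs_le_normd n x i : (i < n)%nat -> Rabs (x i) <= normd n x.
Proof.
  intros Hi. unfold normd. rewrite <- sqrt_Rsqr_abs. apply sqrt_le_1_alt.
  unfold Rsqr. assert (H := sumd_sq_ge n x i Hi). simpl in H. rewrite Rmult_1_r in H. exact H.
Qed.

Lemma sumd_ext n f g : (forall i, (i < n)%nat -> f i = g i) -> sumd n f = sumd n g.
Proof.
  induction n; intros H; simpl; auto. rewrite IHn, (H n) by auto. auto.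
Qed.

Lemma normd_ext n x y : (forall i, (i < n)%nat -> x i = y i) -> normd n x = normd n y.
Proof.
  intros H. unfold normd. f_equal. apply sumd_ext. intros i Hi. now rewrite H.
Qed.

Lemma normd_trunc n x : normd n (trunc n x) = normd n x.
Proof.
  apply normd_ext. intros i Hi. unfold trunc.
  apply Nat.ltb_lt in Hi. now rewrite Hi.
Qed.

Lemma normd_le_sup n x M : 0 <= M -> (forall i, (i < n)%nat -> Rabs (x i) <= M) ->
  normd n x <= sqrt (INR n) * M.
Proof.
  intros HM H. unfold normd. rewrite <- (sqrt_pow2 M) by auto.
  rewrite <- sqrt_mult_alt by apply pos_INR. apply sqrt_le_1_alt.
  induction n as [|n IH]; [simpl; lra|].
  cbn [sumd]. rewrite S_INR.
  assert (sumd n (fun i => x i ^ 2) <= INR n * M ^ 2) by (apply IH; auto).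
  assert (x n ^ 2 <= M ^ 2); [|lra].
  rewrite <- (pow2_abs (x n)). apply pow_incr. split; [apply Rabs_pos|auto].
Qed.

Lemma Rpower_antitone x y a : 0 < x <= y -> 0 <= a -> Rpower y (- a) <= Rpower x (- a).
Proof.
  intros Hx Ha. rewrite !Rpower_Ropp. apply Rinv_le_contravar; [apply Rpower_pos|].
  apply Rle_Rpower_l; lra.
Qed.

Lemma apow_pos_eq x a : 0 < x -> apow x a = Rpower x a.
Proof.
  intros Hx. unfold apow. destruct Req_EM_T; [lra|]. now rewrite Rabs_pos_eq by lra.
Qed.

(** With [d = S m], the choice of [k] means [m (k + 1) = d + beta]: the power of the norm is shared
    equally among the [m] transversal coordinates, and in each factor the norm is bounded below by a
    maximum of two coordinates. *)
Lemma inv_norm_le_maxpow m beta h : (1 <= m)%nat -> 0 < beta -> h O <> 0 ->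
  / apow (normd (S m) h) (INR (S m) + beta) <=
  prodd m (fun i => maxpow ((1 + beta) / INR m) (h O) (h (S i))).
Proof.
  intros Hm Hb Hh. assert (Hm' : 1 <= INR m) by now apply (le_INR 1).
  set (k := (1 + beta) / INR m).
  assert (0 < k) by (apply Rdiv_lt_0_compat; lra).
  assert (Hh' := Rabs_pos_lt _ Hh).
  set (N := normd (S m) h).
  assert (HN : Rabs (h O) <= N) by (apply Rabs_le_normd; lia).
  rewrite apow_pos_eq by lra. rewrite <- Rpower_Ropp.
  replace (- (INR (S m) + beta)) with ((- (k + 1)) * INR m)
    by (unfold k; rewrite S_INR; field; lra).
  rewrite <- Rpower_mult, Rpower_pow by apply Rpower_pos.
  assert (Hj : forall j, (j <= m)%nat ->
    Rpower N (- (k + 1)) ^ j <= prodd j (fun i => maxpow k (h O) (h (S i)))); [|now apply Hj].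
  induction j as [|j IH]; intros Hj; simpl; [lra|]. rewrite Rmult_comm.
  apply Rmult_le_compat.
  - apply pow_le. left; apply Rpower_pos.
  - left; apply Rpower_pos.
  - apply IH; lia.
  - unfold maxpow. replace (- k - 1) with (- (k + 1)) by ring.
    apply Rpower_antitone; [|lra]. split.
    + apply Rlt_le_trans with (Rabs (h O)); auto. apply Rmax_l.
    + apply Rmax_lub; auto. apply Rabs_le_normd; lia.
Qed.

Lemma transversal_const m beta y : (1 <= m)%nat -> 0 < beta -> y <> 0 ->
  let k := (1 + beta) / INR m in
  (2 * (1 + / k) * Rpower (Rabs y) (- k)) ^ m =
  (2 * (1 + / k)) ^ m * Rpower (Rabs y) (- beta - 1).
Proof.
  intros Hm Hb Hy k. assert (Hm' : 1 <= INR m) by now apply (le_INR 1).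
  rewrite Rpow_mult_distr. f_equal. rewrite <- Rpower_pow by apply Rpower_pos.
  rewrite Rpower_mult. f_equal. unfold k. field. lra.
Qed.

(** * Second differences of functions with power growth *)

Lemma Rpower_le_base x y a : 0 < x <= y -> 0 <= a -> Rpower x a <= Rpower y a.
Proof. intros. apply Rle_Rpower_l; lra. Qed.

Lemma Rpower_le_exp_ge1 x a b : 1 <= x -> a <= b -> Rpower x a <= Rpower x b.
Proof.
  intros Hx Hab. apply Rle_Rpower; lra.
Qed.

Lemma Rpower_le_exp_le1 x a b : 0 < x <= 1 -> a <= b -> Rpower x b <= Rpower x a.
Proof.
  intros Hx Hab. unfold Rpower. apply exp_le_compat.
  assert (ln x <= 0); [|nra]. rewrite <- ln_1.
  destruct (proj2 Hx) as [H| ->]; [left; now apply ln_increasing|lra].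
Qed.

Lemma Rpower_sq x a : Rpower x a ^ 2 = Rpower x (2 * a).
Proof.
  rewrite <- Rpower_pow by apply Rpower_pos. rewrite Rpower_mult. f_equal. simpl; ring.
Qed.

Definition second_diff (w : R -> R) (x y : R) : R := w (x + y) - w x - w y + w 0.

Lemma second_diff_sym w x y : second_diff w x y = second_diff w y x.
Proof. unfold second_diff. rewrite (Rplus_comm x y). ring. Qed.

Lemma increment_bound w w' x y B :
  (forall t, derivable_pt_lim w t (w' t)) ->
  (forall t, Rabs (t - x) <= Rabs y -> Rabs (w' t) <= B) ->
  Rabs (w (x + y) - w x) <= Rabs y * B.
Proof.
  intros Hd HB. destruct (MVT_abs w w' x (x + y)) as [c [-> Hc]]; [auto|].
  replace (x + y - x) with y by ring. rewrite Rmult_comm.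
  apply Rmult_le_compat_l; [apply Rabs_pos|]. apply HB.
  unfold Rmin, Rmax, Rabs in *. destruct Rle_dec; repeat destruct Rcase_abs; lra.
Qed.

Lemma Rpower_2_4 r : 0 <= r <= 4 -> Rpower 2 r <= 16.
Proof.
  intros Hr. apply Rle_trans with (Rpower 2 4); [apply Rle_Rpower; lra|].
  replace 4 with (INR 4) by (simpl; ring). rewrite Rpower_pow; lra.
Qed.

(** If [m <= M / 2], the segment from [x] to [x + y] stays at distance between [M / 2] and [2 M]
    from 0; the mean value theorem gives [32 D m M^(r-1)], and [m <= m^s M^(1-s)]. If [m > M / 2],
    both arguments are comparable, the increment is at most [17 D M^r], and [M^r <= 2 m^s M^(r-s)].
    The increment thus costs 34, and the remaining term [w y] adds 1. *)
Lemma second_diff_bound w w' D r s x y :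
  0 < s <= 1 -> s <= r <= 4 -> 0 <= D -> w 0 = 0 ->
  (forall t, derivable_pt_lim w t (w' t)) ->
  (forall t, t <> 0 -> Rabs (w t) <= D * Rpower (Rabs t) r) ->
  (forall t, t <> 0 -> Rabs (w' t) <= D * Rpower (Rabs t) (r - 1)) ->
  0 < Rabs y <= Rabs x ->
  Rabs (second_diff w x y) <= 35 * D * (Rpower (Rabs y) s * Rpower (Rabs x) (r - s)).
Proof.
  intros Hs Hr HD Hw0 Hd Hw Hw' Hyx.
  set (m := Rabs y) in *. set (M := Rabs x) in *.
  set (P := Rpower m s * Rpower M (r - s)).
  assert (HP : 0 < P) by (apply Rmult_lt_0_compat; apply Rpower_pos).
  assert (HDP : 0 <= D * P) by (apply Rmult_le_pos; lra).
  assert (Hy : Rabs (w y) <= D * P).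
  { eapply Rle_trans; [apply Hw; intros ->; unfold m in Hyx; rewrite Rabs_R0 in Hyx; lra|].
    apply Rmult_le_compat_l; auto. fold m. replace r with (s + (r - s)) at 1 by ring.
    rewrite Rpower_plus. apply Rmult_le_compat_l; [left; apply Rpower_pos|].
    apply Rpower_le_base; lra. }
  assert (Hx : Rabs (w (x + y) - w x) <= 34 * (D * P)).
  { destruct (Rle_dec m (M / 2)) as [Hm|Hm].
    - apply Rle_trans with (m * (D * (32 * Rpower M (r - 1)))).
      + apply increment_bound with w'; auto. intros t Ht. fold m in Ht.
        assert (Ht' : M / 2 <= Rabs t <= 2 * M).
        { unfold M, Rabs in *. repeat destruct Rcase_abs; lra. }
        eapply Rle_trans; [apply Hw'; intros ->; rewrite Rabs_R0 in Ht'; lra|].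
        apply Rmult_le_compat_l; auto.
        (* The sign of [r - 1] is not known, so [t^r] and [1 / t] are estimated separately, at
           opposite ends of the range of [|t|]. *)
        replace (r - 1) with (r + - (1)) by ring.
        rewrite !Rpower_plus, !Rpower_Ropp, !Rpower_1 by lra.
        apply Rle_trans with (Rpower (2 * M) r * / (M / 2)).
        * apply Rmult_le_compat; [left; apply Rpower_pos| | |].
          -- left; apply Rinv_0_lt_compat; lra.
          -- apply Rpower_le_base; lra.
          -- apply Rinv_le_contravar; lra.
        * rewrite <- Rpower_mult_distr by lra. rewrite Rinv_div.
          assert (Rpower 2 r <= 16) by (apply Rpower_2_4; lra).
          assert (0 < Rpower M r * / M)
            by (apply Rmult_lt_0_compat; [apply Rpower_pos|apply Rinv_0_lt_compat; lra]).
          replace (Rpower 2 r * Rpower M r * (2 / M)) with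
            (2 * Rpower 2 r * (Rpower M r * / M)) by (unfold Rdiv; ring).
          nra.
      + assert (m * Rpower M (r - 1) <= P); [|nra].
        unfold P. rewrite <- (Rpower_1 m) at 1 by lra.
        replace 1 with (s + (1 - s)) at 1 by ring. rewrite Rpower_plus, Rmult_assoc.
        apply Rmult_le_compat_l; [left; apply Rpower_pos|].
        replace (r - s) with ((1 - s) + (r - 1)) by ring. rewrite Rpower_plus.
        apply Rmult_le_compat_r; [left; apply Rpower_pos|]. apply Rpower_le_base; lra.
    - assert (H1 : Rabs (w (x + y)) <= D * (16 * Rpower M r)).
      { destruct (Req_dec (x + y) 0) as [->|H0].
        - rewrite Hw0, Rabs_R0. assert (0 < Rpower M r) by apply Rpower_pos. nra.
        - eapply Rle_trans; [now apply Hw|]. apply Rmult_le_compat_l; auto.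
          apply Rle_trans with (Rpower (2 * M) r).
          + apply Rpower_le_base; [|lra]. split; [now apply Rabs_pos_lt|].
            eapply Rle_trans; [apply Rabs_triang|]. unfold m, M in *; lra.
          + rewrite <- Rpower_mult_distr by lra. apply Rmult_le_compat_r;
              [left; apply Rpower_pos|apply Rpower_2_4; lra]. }
      assert (H2 : Rabs (w x) <= D * Rpower M r).
      { apply Hw. intros ->. unfold M in Hyx; rewrite Rabs_R0 in Hyx; lra. }
      assert (H3 : Rpower M r <= 2 * P).
      { unfold P. replace r with (s + (r - s)) at 1 by ring. rewrite Rpower_plus, <- Rmult_assoc.
        apply Rmult_le_compat_r; [left; apply Rpower_pos|].
        apply Rle_trans with (Rpower (2 * m) s); [apply Rpower_le_base; lra|].
        rewrite <- Rpower_mult_distr by lra. apply Rmult_le_compat_r; [left; apply Rpower_pos|].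
        rewrite <- (Rpower_1 2) at 2 by lra. apply Rle_Rpower; lra. }
      assert (H4 := Rabs_triang (w (x + y)) (- w x)). rewrite Rabs_Ropp in H4.
      fold (Rminus (w (x + y)) (w x)) in H4.
      assert (D * Rpower M r <= D * (2 * P)) by (apply Rmult_le_compat_l; auto). lra. }
  unfold second_diff. rewrite Hw0, Rplus_0_r.
  assert (H4 := Rabs_triang (w (x + y) - w x) (- w y)). rewrite Rabs_Ropp in H4.
  fold (Rminus (w (x + y) - w x) (w y)) in H4. fold P. lra.
Qed.

(** The split is at [|y| = |x|], where the smaller and the larger argument exchange roles; both
    halves scale like [|x|^(2r-beta)]. [kap] bounds from below the two integrability exponents
    [2 s - beta] and [beta + 2 s - 2 r], so that the constant does not depend on [r]. *)
Lemma lint1_second_diff w w' D r s kap beta Q x :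
  0 < s <= 1 -> s <= r <= 4 -> 0 <= D -> w 0 = 0 ->
  (forall t, derivable_pt_lim w t (w' t)) ->
  (forall t, t <> 0 -> Rabs (w t) <= D * Rpower (Rabs t) r) ->
  (forall t, t <> 0 -> Rabs (w' t) <= D * Rpower (Rabs t) (r - 1)) ->
  0 <= Q -> x <> 0 -> 0 < kap -> kap <= 2 * s - beta -> kap <= beta + 2 * s - 2 * r ->
  lint1_le (fun y => Q * (second_diff w x y ^ 2 * Rpower (Rabs y) (- beta - 1)))
    (Q * (4 * (35 * D) ^ 2 / kap * Rpower (Rabs x) (2 * r - beta))).
Proof.
  intros Hs Hr HD Hw0 Hd Hw Hw' HQ Hx Hk H1 H2.
  assert (Hx' := Rabs_pos_lt x Hx). set (K := 35 * D).
  assert (HK : 0 <= K) by (unfold K; lra).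
  set (A := Q * (K ^ 2 * Rpower (Rabs x) (2 * (r - s)))).
  set (B := Q * (K ^ 2 * Rpower (Rabs x) (2 * s))).
  assert (HQK : 0 <= Q * K ^ 2) by (apply Rmult_le_pos; [|apply pow_le]; lra).
  assert (HA : 0 <= A).
  { unfold A. rewrite <- Rmult_assoc. apply Rmult_le_pos; auto. left; apply Rpower_pos. }
  assert (HB : 0 <= B).
  { unfold B. rewrite <- Rmult_assoc. apply Rmult_le_pos; auto. left; apply Rpower_pos. }
  eapply lint1_le_mono; [intros; apply Rle_refl| |
    apply (lint1_le_power _ A (2 * s - beta) B (beta + 2 * s - 2 * r) (Rabs x))]; auto; try lra.
  - assert (EA : A * Rpower (Rabs x) (2 * s - beta) = Q * K ^ 2 * Rpower (Rabs x) (2 * r - beta)).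
    { unfold A. rewrite !Rmult_assoc, <- Rpower_plus. do 3 f_equal. ring. }
    assert (EB : B * Rpower (Rabs x) (- (beta + 2 * s - 2 * r))
                 = Q * K ^ 2 * Rpower (Rabs x) (2 * r - beta)).
    { unfold B. rewrite !Rmult_assoc, <- Rpower_plus. do 3 f_equal. ring. }
    rewrite EA, EB. set (T := Q * K ^ 2 * Rpower (Rabs x) (2 * r - beta)).
    assert (HT : 0 <= T) by (apply Rmult_le_pos; auto; left; apply Rpower_pos).
    replace (Q * (4 * K ^ 2 / kap * Rpower (Rabs x) (2 * r - beta))) with (2 * (T / kap + T / kap))
      by (unfold T; field; lra).
    apply Rmult_le_compat_l; [lra|]. unfold Rdiv.
    apply Rplus_le_compat; apply Rmult_le_compat_l; auto; apply Rinv_le_contravar; lra.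
  - intros t Ht. unfold A. rewrite !Rmult_assoc. apply Rmult_le_compat_l; auto.
    assert (E := second_diff_bound w w' D r s x t Hs Hr HD Hw0 Hd Hw Hw' ltac:(lra)).
    fold K in E. apply (fun E => pow_incr _ _ 2 (conj (Rabs_pos _) E)) in E.
    rewrite pow2_abs, !Rpow_mult_distr in E.
    rewrite !Rpower_sq in E.
    replace (2 * s - beta - 1) with (2 * s + (- beta - 1)) by ring. rewrite Rpower_plus.
    apply Rmult_le_compat_r with (r := Rpower (Rabs t) (- beta - 1)) in E; [|left; apply Rpower_pos].
    eapply Rle_trans; [exact E|]. right; ring.
  - intros t Ht. unfold B. rewrite !Rmult_assoc. apply Rmult_le_compat_l; auto.
    assert (E := second_diff_bound w w' D r s t x Hs Hr HD Hw0 Hd Hw Hw' ltac:(lra)).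
    rewrite second_diff_sym in E.
    fold K in E. apply (fun E => pow_incr _ _ 2 (conj (Rabs_pos _) E)) in E.
    rewrite pow2_abs, !Rpow_mult_distr in E.
    rewrite !Rpower_sq in E.
    replace (- (beta + 2 * s - 2 * r) - 1) with (2 * (r - s) + (- beta - 1)) by ring.
    rewrite Rpower_plus.
    apply Rmult_le_compat_r with (r := Rpower (Rabs t) (- beta - 1)) in E; [|left; apply Rpower_pos].
    eapply Rle_trans; [exact E|]. right; ring.
Qed.

(** * Growth bounds for the profile, uniform in [eps] *)

(** Meant for the junction [|t| = 1]: the profile bounds the derivative only for [|t| < 1], and
    continuity carries the bound over. *)
Lemma continuity_le_left f x B : continuity f ->
  (forall t, t < x -> x - 1 < t -> f t <= B) -> f x <= B.
Proof.
  intros Hc H. apply Rnot_lt_le; intros Hlt.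
  destruct (Hc x (f x - B) ltac:(lra)) as [e [He Hf]].
  set (t := x - Rmin (e / 2) (1 / 2)).
  assert (0 < Rmin (e / 2) (1 / 2)) by (apply Rmin_glb_lt; lra).
  assert (Rmin (e / 2) (1 / 2) <= e / 2) by apply Rmin_l.
  assert (Rmin (e / 2) (1 / 2) <= 1 / 2) by apply Rmin_r.
  assert (Ht : Rabs (f t - f x) < f x - B).
  { apply Hf. split; [split; [exact I|unfold t; lra]|].
    unfold R_dist, t. simpl. unfold Rdist. rewrite Rabs_left; lra. }
  specialize (H t ltac:(unfold t; lra) ltac:(unfold t; lra)).
  rewrite Rabs_left in Ht; lra.
Qed.

Lemma derivable_even w w' :
  (forall x, w (- x) = w x) -> (forall x, derivable_pt_lim w x (w' x)) ->
  forall x, w' (- x) = - w' x.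
Proof.
  intros He Hd x. apply (uniqueness_limite w (- x)); auto.
  intros e Hpos. destruct (Hd x e Hpos) as [dl H]. exists dl. intros h Hh Hl.
  specialize (H (- h) ltac:(lra) ltac:(now rewrite Rabs_Ropp)).
  replace (w (- x + h)) with (w (x + - h)) by (rewrite <- He; f_equal; ring). rewrite He.
  replace ((w (x + - h) - w x) / h - - w' x) with (- ((w (x + - h) - w x) / (- h) - w' x))
    by (field; auto).
  now rewrite Rabs_Ropp.
Qed.

(** All exponents [r] of the range work at once: for [|t| < 1] the power with exponent
    [beta + delta] is the smallest of them, for [|t| >= 1] the one with [beta - eps] is. In
    [Lam + 2], [Lam] serves the inner region, and 2 bounds the factor [beta - eps] of the derivative
    outside. *)
Lemma profile_facts beta Lam delta eps w :
  0 < beta < 2 -> 0 < Lam -> 0 < delta -> 1 < beta + delta -> 0 < eps < beta ->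
  u_profile beta Lam delta eps w ->
  w 0 = 0 /\ (forall t, 0 <= w t) /\ exists w', (forall t, derivable_pt_lim w t (w' t)) /\
  forall r, beta - eps <= r <= beta + delta -> forall t, t <> 0 ->
    Rabs (w t) <= (Lam + 2) * Rpower (Rabs t) r /\
    Rabs (w' t) <= (Lam + 2) * Rpower (Rabs t) (r - 1).
Proof.
  intros Hb HL Hdl Hbd He [[w' [Hd [Hc Hw']]] [Heven [Hbig Hsm]]].
  assert (Habs : forall t, w t = w (Rabs t)).
  { intros t. unfold Rabs. destruct Rcase_abs; auto. }
  assert (Habs' : forall t, Rabs (w' t) = Rabs (w' (Rabs t))).
  { intros t. unfold Rabs at 3. destruct Rcase_abs; auto.
    rewrite (derivable_even w w'), Rabs_Ropp by auto. auto. }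
  assert (Hder : forall t, 1 < t -> w' t = (beta - eps) * Rpower t (beta - eps - 1)).
  { intros t Ht. apply (uniqueness_limite w t); auto.
    intros e Hpos. destruct (derivable_pt_lim_power t (beta - eps) ltac:(lra) e Hpos) as [dl H].
    assert (Hmin : 0 < Rmin dl (t - 1)) by (apply Rmin_glb_lt; [apply cond_pos|lra]).
    exists (mkposreal _ Hmin). simpl. intros h Hh Hl.
    assert (Rabs h < dl) by (eapply Rlt_le_trans; [exact Hl|apply Rmin_l]).
    assert (Rabs h < t - 1) by (eapply Rlt_le_trans; [exact Hl|apply Rmin_r]).
    assert (1 < t + h) by (unfold Rabs in *; destruct Rcase_abs; lra).
    rewrite !Hbig by (rewrite Rabs_pos_eq; lra). rewrite !apow_pos_eq by lra. auto. }
  split; [|split].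
  - specialize (Hsm 0). rewrite Rabs_R0 in Hsm. specialize (Hsm ltac:(lra)).
    unfold apow in Hsm. destruct Req_EM_T; lra.
  - intros t. destruct (Rlt_dec (Rabs t) 1) as [H|H]; [now apply Hsm|].
    rewrite Hbig by lra. unfold apow. destruct Req_EM_T; [lra|left; apply Rpower_pos].
  - exists w'. split; auto. intros r Hr t Ht.
    assert (Hp := Rabs_pos_lt t Ht). rewrite Habs, Habs'.
    set (a := Rabs t) in *. clearbody a. clear t Ht Habs Habs'.
    assert (Ha : Rabs a = a) by (rewrite Rabs_pos_eq; lra).
    assert (HR := Rpower_pos a r). assert (HR1 := Rpower_pos a (r - 1)).
    split.
    + destruct (Rlt_dec a 1) as [H|H].
      * destruct (Hsm a ltac:(lra)) as [H1 H2]. rewrite Rabs_pos_eq by lra.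
        rewrite apow_pos_eq in H2 by lra.
        assert (Rpower a (beta + delta) <= Rpower a r) by (apply Rpower_le_exp_le1; lra). nra.
      * rewrite Hbig, apow_pos_eq by lra. rewrite Rabs_pos_eq by (left; apply Rpower_pos).
        assert (Rpower a (beta - eps) <= Rpower a r) by (apply Rpower_le_exp_ge1; lra). nra.
    + destruct (Rtotal_order a 1) as [H|[->|H]].
      * assert (H2 := Hw' a ltac:(lra)). rewrite apow_pos_eq in H2 by lra.
        assert (Rpower a (beta + delta - 1) <= Rpower a (r - 1)) by (apply Rpower_le_exp_le1; lra).
        nra.
      * rewrite Rpower_1_l. apply Rle_trans with Lam; [|lra].
        apply (continuity_le_left (fun t => Rabs (w' t))).
        -- intros t. apply (continuity_pt_comp w' Rabs); [apply Hc|apply Rcontinuity_abs].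
        -- intros t H1 H2. eapply Rle_trans; [apply Hw'; rewrite Rabs_pos_eq; lra|].
           rewrite apow_pos_eq by lra. rewrite <- (Rmult_1_r Lam) at 2.
           apply Rmult_le_compat_l; [lra|]. apply Rle_trans with (Rpower 1 (beta + delta - 1));
             [apply Rpower_le_base; lra|rewrite Rpower_1_l; lra].
      * rewrite Hder by lra. rewrite Rabs_pos_eq
          by (apply Rmult_le_pos; [lra|left; apply Rpower_pos]).
        assert (Rpower a (beta - eps - 1) <= Rpower a (r - 1)) by (apply Rpower_le_exp_ge1; lra).
        assert (0 < Rpower a (beta - eps - 1)) by apply Rpower_pos. nra.
Qed.

(** * Finiteness of the two integrals *)

(** The dimension is [S m]. The factor 2 is [w h + w (- h)] for an even [w] with [w 0 = 0]. *)
Definition L_integrand (beta : R) (m : nat) (w : R -> R) (z : nat -> R) : R :=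
  2 * c_const beta (S m) * w (z O) * / apow (normd (S m) z) (INR (S m) + beta).

Definition Gamma2_integrand (beta : R) (m : nat) (w : R -> R) (z : nat -> R) : R :=
  c_const beta (S m) ^ 2 * second_diff w (z O) (z (S m)) ^ 2 *
  / apow (normd (S m) z) (INR (S m) + beta) *
  / apow (normd (S m) (fun i => z (S m + i)%nat)) (INR (S m) + beta).

Lemma L_is_first_coord beta m w I :
  w 0 = 0 -> (forall t, w (- t) = w t) ->
  integral_is (S m) (L_integrand beta m w) I ->
  L_is beta (S m) (fun x => w (x O)) vzero I.
Proof.
  intros H0 He. apply integral_is_ext. intros z. cbv zeta. rewrite normd_trunc.
  unfold L_integrand, vadd, vsub, vzero.
  replace (trunc (S m) z O) with (z O) by reflexivity.
  rewrite Rplus_0_l, Rminus_0_l, He, H0. unfold Rdiv. ring.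
Qed.

Lemma Gamma2_is_first_coord beta m w I :
  integral_is (2 * S m) (Gamma2_integrand beta m w) I ->
  Gamma2_is beta (S m) (fun x => w (x O)) vzero I.
Proof.
  apply integral_is_ext. intros z. cbv zeta. rewrite !normd_trunc.
  unfold Gamma2_integrand, second_diff, vadd, vsub, vzero.
  replace (trunc (S m) z O) with (z O) by reflexivity.
  replace (trunc (S m) (fun i => z (S m + i)%nat) O) with (z (S m + 0)%nat) by reflexivity.
  rewrite Nat.add_0_r, !Rplus_0_l. unfold Rdiv. rewrite Rinv_mult. ring.
Qed.

Lemma inv_apow_nonneg x a : 0 <= / apow x a.
Proof.
  unfold apow. destruct Req_EM_T; [rewrite Rinv_0; lra|].
  left; apply Rinv_0_lt_compat, Rpower_pos.
Qed.

Lemma L_integrand_nonneg beta m w z : 0 < beta < 2 -> (forall t, 0 <= w t) ->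
  0 <= L_integrand beta m w z.
Proof.
  intros Hb Hw. assert (H := c_const_pos beta (S m) Hb). unfold L_integrand.
  apply Rmult_le_pos; [|apply inv_apow_nonneg]. apply Rmult_le_pos; auto. lra.
Qed.

Lemma Gamma2_integrand_nonneg beta m w z : 0 <= Gamma2_integrand beta m w z.
Proof.
  unfold Gamma2_integrand.
  do 2 (apply Rmult_le_pos; [|apply inv_apow_nonneg]).
  apply Rmult_le_pos; apply pow2_ge_0.
Qed.

Lemma L_lint beta m w D p q : (1 <= m)%nat -> 0 < beta < 2 -> 0 <= D ->
  w 0 = 0 -> (forall t, 0 <= w t) -> p < beta < q ->
  (forall t, t <> 0 -> Rabs (w t) <= D * Rpower (Rabs t) p /\ Rabs (w t) <= D * Rpower (Rabs t) q) ->
  exists C, lint_le (S m) (L_integrand beta m w) C.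
Proof.
  intros Hm Hb HD H0 Hw Hpq HwD. assert (Hc := c_const_pos beta (S m) Hb).
  set (c := c_const beta (S m)) in *. set (k := (1 + beta) / INR m).
  assert (Hm' : 1 <= INR m) by now apply (le_INR 1).
  assert (Hk : 0 < k) by (apply Rdiv_lt_0_compat; lra).
  set (T := (2 * (1 + / k)) ^ m).
  assert (HT : 0 <= T) by (apply pow_le; assert (0 < / k) by (apply Rinv_0_lt_compat; auto); lra).
  set (A := 2 * c * D * T). assert (HA : 0 <= A) by (unfold A; repeat (apply Rmult_le_pos; try lra)).
  exists (2 * (A * Rpower 1 (q - beta) / (q - beta) + A * Rpower 1 (- (beta - p)) / (beta - p))).
  eapply lint_le_mono with
    (g := fun z => 2 * c * w (z O) * prodd m (fun i => maxpow k (z O) (z (O + S i)%nat)));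
    [|apply Rle_refl|].
  { intros z. unfold L_integrand. fold c. destruct (Req_dec (z O) 0) as [E|E].
    - rewrite E, H0. lra.
    - apply Rmult_le_compat_l; [apply Rmult_le_pos; auto; lra|].
      apply inv_norm_le_maxpow; auto. lra. }
  apply (lint_le_transversal k 0 m (fun z => 2 * c * w (z O))); auto.
  - intros z. apply Rmult_le_pos; auto; lra.
  - intros z i t Hi. rewrite upd_neq by lia. auto.
  - intros z ->. rewrite H0. ring.
  - apply lint_le_dim1 with (fun t => 2 * c * w t * (T * Rpower (Rabs t) (- beta - 1))).
    + intros z. destruct (Req_dec (z O) 0) as [->|E]; [rewrite H0; lra|].
      right. f_equal. apply (transversal_const m beta (z O)); auto; lra.
    + apply (lint1_le_power _ A (q - beta) A (beta - p) 1); try lra.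
      * intros t Ht. replace (q - beta - 1) with (q + (- beta - 1)) by ring.
        rewrite Rpower_plus. destruct (HwD t) as [_ H]; [intros ->; rewrite Rabs_R0 in Ht; lra|].
        assert (H1 := Rle_abs (w t)). unfold A.
        replace (2 * c * D * T * _) with
          (2 * c * (D * Rpower (Rabs t) q) * (T * Rpower (Rabs t) (- beta - 1))) by ring.
        apply Rmult_le_compat_r; [apply Rmult_le_pos; auto; left; apply Rpower_pos|].
        apply Rmult_le_compat_l; lra.
      * intros t Ht. replace (- (beta - p) - 1) with (p + (- beta - 1)) by ring.
        rewrite Rpower_plus. destruct (HwD t) as [H _]; [intros ->; rewrite Rabs_R0 in Ht; lra|].
        assert (H1 := Rle_abs (w t)). unfold A.
        replace (2 * c * D * T * _) with
          (2 * c * (D * Rpower (Rabs t) p) * (T * Rpower (Rabs t) (- beta - 1))) by ring.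
        apply Rmult_le_compat_r; [apply Rmult_le_pos; auto; left; apply Rpower_pos|].
        apply Rmult_le_compat_l; lra.
Qed.

Lemma Gamma2_lint beta m w w' D s p q kap :
  (1 <= m)%nat -> 0 < beta < 2 -> 0 <= D -> 0 < s <= 1 -> s <= p < beta -> beta < q <= 4 ->
  0 < kap -> kap <= 2 * s - beta -> kap <= beta + 2 * s - 2 * q ->
  w 0 = 0 -> (forall t, derivable_pt_lim w t (w' t)) ->
  (forall r, r = p \/ r = q -> forall t, t <> 0 ->
    Rabs (w t) <= D * Rpower (Rabs t) r /\ Rabs (w' t) <= D * Rpower (Rabs t) (r - 1)) ->
  let A := (c_const beta (S m) * (2 * (1 + / ((1 + beta) / INR m))) ^ m) ^ 2 *
           (4 * (35 * D) ^ 2 / kap) in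
  lint_le (2 * S m) (Gamma2_integrand beta m w)
    (2 * (A / (2 * (q - beta)) + A / (2 * (beta - p)))).
Proof.
  intros Hm Hb HD Hs Hp Hq Hkap Hk1 Hk2 H0 Hd HwD A. assert (Hc := c_const_pos beta (S m) Hb).
  set (c := c_const beta (S m)) in *. set (k := (1 + beta) / INR m) in *.
  assert (Hm' : 1 <= INR m) by now apply (le_INR 1).
  assert (Hk : 0 < k) by (apply Rdiv_lt_0_compat; lra).
  set (T := (2 * (1 + / k)) ^ m) in *.
  assert (HT : 0 <= T) by (apply pow_le; assert (0 < / k) by (apply Rinv_0_lt_compat; auto); lra).
  set (B := 4 * (35 * D) ^ 2 / kap) in *.
  assert (HB : 0 <= B).
  { apply Rle_mult_inv_pos; auto. apply Rmult_le_pos; [lra|apply pow2_ge_0]. }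
  assert (HA : 0 <= A) by (apply Rmult_le_pos; auto; apply pow2_ge_0).
  (* Bound for the integral over the first coordinate of [sigma], given the first coordinate [x] of
     [h]. The growth exponent may depend on [x]: [q] near the origin, [p] far away. *)
  set (Kin := fun x => if Req_EM_T x 0 then 0 else
    B * Rpower (Rabs x) (2 * (if Rlt_dec (Rabs x) 1 then q else p) - beta)).
  assert (HKin : forall x, 0 <= Kin x).
  { intros x. unfold Kin. destruct Req_EM_T; [lra|].
    apply Rmult_le_pos; auto. left; apply Rpower_pos. }
  assert (Hc2 := pow2_ge_0 c).
  set (ia := fun z => / apow (normd (S m) z) (INR (S m) + beta)).
  assert (Hia : forall z, 0 <= ia z) by (intros; apply inv_apow_nonneg).
  assert (Hiaupd : forall z i t, (m < i)%nat -> ia (upd z i t) = ia z).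
  { intros z i t Hi. unfold ia. do 2 f_equal. apply normd_ext. intros j Hj. apply upd_neq. lia. }
  assert (Hsd0 : forall x, second_diff w x 0 = 0).
  { intros x. unfold second_diff. rewrite Rplus_0_r. ring. }
  (* Slicing removes the last coordinate first: the [m] transversal coordinates of [sigma], then its
     first one, which has index [S m], then those of [h] in the same order. *)
  replace (2 * S m)%nat with (S (S m) + m)%nat by lia.
  set (g1 := fun z => c ^ 2 * second_diff w (z O) (z (S m)) ^ 2 * ia z).
  assert (Hg1 : forall z, 0 <= g1 z).
  { intros z. unfold g1. apply Rmult_le_pos; auto. apply Rmult_le_pos; auto. apply pow2_ge_0. }
  apply lint_le_mono with
    (g := fun z => g1 z * prodd m (fun i => maxpow k (z (S m)) (z (S m + S i)%nat)))
    (C := 2 * (A / (2 * (q - beta)) + A / (2 * (beta - p)))); [|apply Rle_refl|].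
  { intros z. unfold Gamma2_integrand. fold c.
    change (/ apow (normd (S m) z) (INR (S m) + beta)) with (ia z). fold (g1 z).
    destruct (Req_dec (z (S m)) 0) as [E|E].
    - unfold g1. rewrite E, Hsd0. simpl. lra.
    - apply Rmult_le_compat_l.
      + auto.
      + assert (H := inv_norm_le_maxpow m beta (fun i => z (S m + i)%nat) Hm ltac:(lra)).
        cbv beta in H. rewrite Nat.add_0_r in H. apply H. auto. }
  apply (lint_le_transversal k (S m) m g1); auto.
  { intros z i t Hi. unfold g1. rewrite Hiaupd, !upd_neq by lia. auto. }
  { intros z E. unfold g1. rewrite E, Hsd0. simpl. ring. }
  apply lint_le_fubini with (fun z => c ^ 2 * T * ia z * Kin (z O)).
  { intros z. destruct (Req_dec (z O) 0) as [E|E].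
    - replace (Kin (z O)) with 0 by (unfold Kin; destruct Req_EM_T; lra).
      rewrite Rmult_0_r. apply lint1_le_0. intros t. unfold g1.
      rewrite (upd_neq _ _ _ O), E, second_diff_sym, Hsd0 by lia. simpl. lra.
    - set (Q := c ^ 2 * T * ia z).
      assert (HQ : 0 <= Q) by (repeat (apply Rmult_le_pos; auto)).
      apply lint1_le_mono with
        (g := fun y => Q * (second_diff w (z O) y ^ 2 * Rpower (Rabs y) (- beta - 1)))
        (C := Q * Kin (z O)); [|apply Rle_refl|].
      + intros t. unfold g1. rewrite Hiaupd, (upd_neq _ _ _ O), upd_eq by lia.
        destruct (Req_dec t 0) as [->|Et].
        * rewrite Hsd0. simpl. lra.
        * right. unfold k. rewrite transversal_const by (auto; lra). fold k T.
          unfold Q. ring.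
      + unfold Kin. destruct Req_EM_T as [E'|_]; [lra|]. unfold B.
        destruct (Rlt_dec (Rabs (z O)) 1);
          (apply (lint1_second_diff w w' D _ s kap beta Q (z O)); auto; try lra;
           intros t Ht; apply HwD; auto). }
  apply lint_le_mono with
    (g := fun z => c ^ 2 * T * Kin (z O) * prodd m (fun i => maxpow k (z O) (z (O + S i)%nat)))
    (C := 2 * (A / (2 * (q - beta)) + A / (2 * (beta - p)))); [|apply Rle_refl|].
  { intros z. destruct (Req_dec (z O) 0) as [E|E].
    - replace (Kin (z O)) with 0 by (unfold Kin; destruct Req_EM_T; lra). lra.
    - replace (c ^ 2 * T * ia z * Kin (z O)) with (c ^ 2 * T * Kin (z O) * ia z) by ring.
      apply Rmult_le_compat_l; [repeat (apply Rmult_le_pos; auto)|].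
      apply inv_norm_le_maxpow; auto. lra. }
  apply (lint_le_transversal k 0 m (fun z => c ^ 2 * T * Kin (z O))); auto.
  { intros z. repeat (apply Rmult_le_pos; auto). }
  { intros z i t Hi. rewrite upd_neq by lia. auto. }
  { intros z E. unfold Kin. destruct Req_EM_T; lra. }
  apply lint_le_dim1 with (fun t => c ^ 2 * T * Kin t * (T * Rpower (Rabs t) (- beta - 1))).
  { intros z. destruct (Req_dec (z O) 0) as [E|E].
    - replace (Kin (z O)) with 0 by (unfold Kin; destruct Req_EM_T; lra). lra.
    - right. f_equal. unfold k. rewrite transversal_const by (auto; lra). reflexivity. }
  (* The remaining power is [|t|^(2r-2beta-1)]; its tail with [r = p] yields the term with
     [beta - p], which becomes [eps]. *)
  eapply lint1_le_mono; [intros; apply Rle_refl| |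
    apply (lint1_le_power _ A (2 * (q - beta)) A (2 * (beta - p)) 1)]; try lra.
  - rewrite !Rpower_1_l, !Rmult_1_r. lra.
  - intros t Ht. unfold Kin. destruct Req_EM_T as [->|_]; [rewrite Rabs_R0 in Ht; lra|].
    destruct Rlt_dec; [|lra].
    replace (2 * (q - beta) - 1) with ((2 * q - beta) + (- beta - 1)) by ring.
    rewrite Rpower_plus. right. unfold A. ring.
  - intros t Ht. unfold Kin. destruct Req_EM_T as [->|_]; [rewrite Rabs_R0 in Ht; lra|].
    destruct Rlt_dec; [lra|].
    replace (- (2 * (beta - p)) - 1) with ((2 * p - beta) + (- beta - 1)) by ring.
    rewrite Rpower_plus. right. unfold A. ring.
Qed.

(** * Lower bounds from explicit step functions *)

Lemma box_ind_cases n a b x :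
  box_ind n a b x = 0 \/
  (box_ind n a b x = 1 /\ forall i, (i < n)%nat -> a i <= x i <= b i).
Proof.
  induction n as [|n IH]; simpl; [right; split; auto; lia|].
  destruct (Rle_dec (a n) (x n)); [destruct (Rle_dec (x n) (b n))|]; try (left; ring).
  destruct IH as [->|[-> IH]]; [left; ring|right]. split; [ring|].
  intros i Hi. destruct (Nat.eq_dec i n) as [->|]; [lra|]. apply IH. lia.
Qed.

Lemma prodd_const n c : prodd n (fun _ => c) = c ^ n.
Proof. induction n as [|n IH]; simpl; [auto|]. rewrite IH. ring. Qed.

(** The boxes are closed; the factor 3/2 instead of 2 keeps them disjoint, already in the first
    coordinate. So at each point at most one term counts, and each cube can be compared with the
    integrand separately. *)
Fixpoint dyadic_cubes (coef : nat -> R) (n : nat) : step :=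
  match n with
  | O => nil
  | S k => (coef k, (fun _ => 2 ^ k, fun _ => 3 / 2 * 2 ^ k)) :: dyadic_cubes coef k
  end.

Lemma dyadic_cubes_far d coef n x : 2 ^ n <= x O -> step_val (S d) (dyadic_cubes coef n) x = 0.
Proof.
  intros Hx. induction n as [|n IH]; [easy|]. cbn [dyadic_cubes step_val fold_right fst snd].
  assert (0 < 2 ^ n) by (apply pow_lt; lra).
  simpl in Hx. fold (step_val (S d) (dyadic_cubes coef n) x). rewrite IH by lra.
  destruct (box_ind_cases (S d) (fun _ => 2 ^ n) (fun _ => 3 / 2 * 2 ^ n) x) as [->|[_ Hi]]; [ring|].
  specialize (Hi O ltac:(lia)). simpl in Hi. lra.
Qed.

Lemma dyadic_cubes_lower d f coef n :
  (forall k, 0 <= coef k) -> (forall x, 0 <= f x) ->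
  (forall k x, (forall i, (i < S d)%nat -> 2 ^ k <= x i <= 3 / 2 * 2 ^ k) -> coef k <= f x) ->
  forall x, step_val (S d) (dyadic_cubes coef n) x <= f x.
Proof.
  intros Hc Hf H x. induction n as [|n IH]; [apply Hf|].
  cbn [dyadic_cubes step_val fold_right fst snd].
  fold (step_val (S d) (dyadic_cubes coef n) x).
  destruct (box_ind_cases (S d) (fun _ => 2 ^ n) (fun _ => 3 / 2 * 2 ^ n) x) as [->|[-> Hi]]; [lra|].
  rewrite dyadic_cubes_far by (apply (Hi O); lia). specialize (H n x Hi). lra.
Qed.

Lemma dyadic_cubes_ok d coef n : (forall k, 0 <= coef k) -> step_ok d (dyadic_cubes coef n).
Proof.
  intros Hc. induction n as [|n IH]; constructor; auto. simpl. split; auto. intros _ _.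
  assert (0 < 2 ^ n) by (apply pow_lt; lra). lra.
Qed.

Lemma dyadic_cubes_int d coef n e :
  (forall k, (k < n)%nat -> e <= coef k * (1 / 2 * 2 ^ k) ^ d) ->
  INR n * e <= step_int d (dyadic_cubes coef n).
Proof.
  induction n as [|n IH]; intros H; [simpl; lra|].
  cbn [dyadic_cubes step_int fold_right fst snd]. fold (step_int d (dyadic_cubes coef n)).
  unfold box_vol. rewrite prodd_const, S_INR.
  replace (3 / 2 * 2 ^ n - 2 ^ n) with (1 / 2 * 2 ^ n) by lra.
  assert (H1 := H n ltac:(lia)). assert (H2 := IH ltac:(auto)). lra.
Qed.

Lemma nat_ceil x : 0 < x -> exists n, x <= INR (S n) /\ INR n <= x.
Proof.
  intros Hx. destruct (archimed x) as [H1 H2].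
  assert (0 < up x)%Z by (apply lt_IZR; lra).
  exists (Z.to_nat (up x - 1)). rewrite S_INR, INR_IZR_INZ, Z2Nat.id by lia.
  rewrite minus_IZR. lra.
Qed.

Lemma L_lower beta m w eps : 0 < beta < 2 -> 0 < eps < beta ->
  (forall t, 0 <= w t) -> (forall t, 1 <= t -> w t = Rpower t (beta - eps)) ->
  exists r, lower_set (S m) (L_integrand beta m w) r /\
    c_const beta (S m) * / Rpower (2 * sqrt (INR (S m))) (INR (S m) + beta) * (1 / 2) ^ S m / eps
    <= r.
Proof.
  intros Hb He Hw Hbig. assert (Hc := c_const_pos beta (S m) Hb).
  set (c := c_const beta (S m)) in *. set (d := S m) in *. set (S0 := 2 * sqrt (INR d)).
  assert (HS : 0 < S0) by (apply Rmult_lt_0_compat; [lra|apply sqrt_lt_R0, lt_0_INR; lia]).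
  set (c0 := c * / Rpower S0 (INR d + beta)).
  assert (Hc0 : 0 < c0) by (apply Rmult_lt_0_compat; auto; apply Rinv_0_lt_compat, Rpower_pos).
  (* On the cube of index [k] the profile is at least [(2^k)^(beta-eps)] and the norm is at most
     [S0 2^k]; [coef k] is the resulting lower bound of the integrand. *)
  set (coef := fun k => 2 * c0 * Rpower (2 ^ k) (- eps - INR d)).
  assert (Hpos : forall k, 0 <= coef k).
  { intros k. apply Rmult_le_pos; [lra|left; apply Rpower_pos]. }
  (* The [n + 1] cubes number at least [1 / eps], yet every index satisfies [k eps <= 1]. So the
     decay [2^(-k eps)] is at least 1/2, which the factor 2 in [coef] absorbs. *)
  destruct (nat_ceil (/ eps)) as [n [Hn1 Hn2]]; [apply Rinv_0_lt_compat; lra|].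
  exists (step_int d (dyadic_cubes coef (S n))). split.
  - exists (dyadic_cubes coef (S n)). split; [|split; auto].
    + now apply dyadic_cubes_ok.
    + apply dyadic_cubes_lower; auto.
      * intros; now apply L_integrand_nonneg.
      * intros k x Hx. assert (Hx0 := Hx O ltac:(lia)).
        assert (H2k : 1 <= 2 ^ k) by (apply pow_R1_Rle; lra).
        assert (HN1 : x O <= normd d x).
        { eapply Rle_trans; [apply Rle_abs|]. apply Rabs_le_normd; lia. }
        assert (HN2 : normd d x <= S0 * 2 ^ k).
        { replace (S0 * 2 ^ k) with (sqrt (INR d) * (2 * 2 ^ k)) by (unfold S0; ring).
          apply normd_le_sup; [lra|]. intros i Hi. specialize (Hx i Hi).
          rewrite Rabs_pos_eq; lra. }
        unfold L_integrand, coef, c0. fold d c. rewrite Hbig, apow_pos_eq by lra.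
        replace (- eps - INR d) with ((beta - eps) + - (INR d + beta)) by ring.
        rewrite (Rpower_plus (beta - eps)), Rpower_Ropp.
        replace (2 * (c * / Rpower S0 (INR d + beta)) *
                 (Rpower (2 ^ k) (beta - eps) * / Rpower (2 ^ k) (INR d + beta)))
          with (2 * c * Rpower (2 ^ k) (beta - eps) * / Rpower (S0 * 2 ^ k) (INR d + beta)).
        2:{ rewrite <- Rpower_mult_distr, Rinv_mult by lra. ring. }
        apply Rmult_le_compat.
        -- apply Rmult_le_pos; [lra|left; apply Rpower_pos].
        -- left; apply Rinv_0_lt_compat, Rpower_pos.
        -- apply Rmult_le_compat_l; [lra|]. apply Rpower_le_base; lra.
        -- apply Rinv_le_contravar; [apply Rpower_pos|]. apply Rpower_le_base; [lra|].
           assert (0 <= INR d) by apply pos_INR. lra.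
  - apply Rle_trans with (INR (S n) * (c0 * (1 / 2) ^ d)).
    + unfold Rdiv at 1. rewrite Rmult_comm. apply Rmult_le_compat_r; auto.
      apply Rmult_le_pos; [lra|apply pow_le; lra].
    + apply dyadic_cubes_int. intros k Hk.
      assert (H2k : 0 < 2 ^ k) by (apply pow_lt; lra).
      unfold coef. rewrite Rpow_mult_distr, <- (Rpower_pow d (2 ^ k)) by auto.
      replace (2 * c0 * Rpower (2 ^ k) (- eps - INR d) * ((1 / 2) ^ d * Rpower (2 ^ k) (INR d)))
        with (c0 * (1 / 2) ^ d * (2 * (Rpower (2 ^ k) (- eps - INR d) * Rpower (2 ^ k) (INR d))))
        by ring.
      rewrite <- Rpower_plus. rewrite <- (Rmult_1_r (c0 * (1 / 2) ^ d)) at 1.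
      apply Rmult_le_compat_l; [apply Rmult_le_pos; [lra|apply pow_le; lra]|].
      replace (- eps - INR d + INR d) with (- eps) by ring.
      rewrite <- (Rpower_pow k), Rpower_mult by lra.
      assert (Hke : INR k * eps <= 1).
      { assert (INR k <= INR n) by (apply le_INR; lia).
        apply Rmult_le_reg_r with (/ eps); [apply Rinv_0_lt_compat; lra|].
        rewrite Rmult_assoc, Rinv_r by lra. lra. }
      apply Rle_trans with (2 * Rpower 2 (- (1))).
      * rewrite Rpower_Ropp, Rpower_1 by lra. lra.
      * apply Rmult_le_compat_l; [lra|]. apply Rle_Rpower; lra.
Qed.

(** The difference equals [x ((x+y)^(p-1) - x^(p-1))] plus the same with [x] and [y] exchanged. Both
    terms have the sign of [p - 1], so they cannot cancel; since [x + y >= 3/2 x] and [x^p >= 1] on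
    this square, each has absolute value at least [|t - 1|]. *)
Lemma second_diff_power p : 0 < p -> p <> 1 ->
  exists e, 0 < e /\ forall x y, 1 <= x <= 2 -> 1 <= y <= 2 ->
    e <= (Rpower (x + y) p - Rpower x p - Rpower y p) ^ 2.
Proof.
  intros Hp Hp1. set (t := Rpower (3 / 2) (p - 1)).
  assert (Ht : t - 1 <> 0).
  { unfold t. intros E. destruct (Rdichotomy p 1 Hp1) as [H|H].
    - assert (Rpower (3 / 2) (p - 1) < Rpower (3 / 2) 0) by (apply Rpower_lt; lra).
      rewrite Rpower_O in *; lra.
    - assert (Rpower (3 / 2) 0 < Rpower (3 / 2) (p - 1)) by (apply Rpower_lt; lra).
      rewrite Rpower_O in *; lra. }
  exists ((t - 1) ^ 2). split; [rewrite <- Rsqr_pow2; now apply Rsqr_pos_lt|].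
  assert (Hsplit : forall x y, 1 <= x <= 2 -> 1 <= y <= 2 ->
    Rpower (x + y) p = x * Rpower (x + y) (p - 1) + y * Rpower (x + y) (p - 1)).
  { intros x y Hx Hy. rewrite <- Rmult_plus_distr_r. rewrite <- (Rpower_1 (x + y)) at 2 by lra.
    rewrite <- Rpower_plus. f_equal. ring. }
  assert (Hx3 : forall x y, 1 <= x <= 2 -> 1 <= y <= 2 ->
    (1 < p -> (t - 1) <= x * Rpower (x + y) (p - 1) - Rpower x p) /\
    (p < 1 -> (1 - t) <= Rpower x p - x * Rpower (x + y) (p - 1))).
  { intros x y Hx Hy.
    assert (E1 : Rpower x p = x * Rpower x (p - 1)).
    { rewrite <- (Rpower_1 x) at 2 by lra. rewrite <- Rpower_plus. f_equal. ring. }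
    assert (E2 : Rpower (3 / 2 * x) (p - 1) = t * Rpower x (p - 1))
      by (rewrite <- Rpower_mult_distr by lra; reflexivity).
    assert (Hge : 1 <= Rpower x p).
    { rewrite <- (Rpower_O x) by lra. apply Rle_Rpower; lra. }
    split; intros Hp'.
    - assert (Rpower (3 / 2 * x) (p - 1) <= Rpower (x + y) (p - 1)) by (apply Rpower_le_base; lra).
      assert (x * (t * Rpower x (p - 1)) <= x * Rpower (x + y) (p - 1))
        by (apply Rmult_le_compat_l; lra).
      assert (0 <= t - 1).
      { unfold t. rewrite <- (Rpower_O (3 / 2)) at 2 by lra.
        assert (Rpower (3 / 2) 0 <= Rpower (3 / 2) (p - 1)) by (apply Rle_Rpower; lra). lra. }
      nra.
    - assert (Rpower (x + y) (p - 1) <= Rpower (3 / 2 * x) (p - 1)).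
      { replace (p - 1) with (- (1 - p)) by ring. apply Rpower_antitone; lra. }
      assert (x * Rpower (x + y) (p - 1) <= x * (t * Rpower x (p - 1)))
        by (apply Rmult_le_compat_l; lra).
      assert (0 <= 1 - t).
      { unfold t.
        assert (Rpower (3 / 2) (p - 1) <= Rpower (3 / 2) 0) by (apply Rle_Rpower; lra).
        rewrite Rpower_O in *; lra. }
      nra. }
  intros x y Hx Hy. rewrite (Hsplit x y) by auto.
  destruct (Hx3 x y Hx Hy) as [U1 U2]. destruct (Hx3 y x Hy Hx) as [V1 V2].
  rewrite (Rplus_comm y x) in V1, V2.
  destruct (Rdichotomy p 1 Hp1) as [H|H].
  - specialize (U2 H). specialize (V2 H).
    assert (0 <= 1 - t).
    { unfold t.
      assert (Rpower (3 / 2) (p - 1) <= Rpower (3 / 2) 0) by (apply Rle_Rpower; lra).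
      rewrite Rpower_O in *; lra. }
    nra.
  - specialize (U1 H). specialize (V1 H).
    assert (0 <= t - 1).
    { unfold t.
      assert (Rpower (3 / 2) 0 <= Rpower (3 / 2) (p - 1)) by (apply Rle_Rpower; lra).
      rewrite Rpower_O in *; lra. }
    nra.
Qed.

(** One box suffices: on [[1, 2]^(2d)] the arguments [x], [y], [x + y] are all at least 1, where the
    profile is a pure power, and the fourth term is [w 0 = 0]. *)
Lemma Gamma2_lower beta m w p : 0 < beta < 2 -> 0 < p -> p <> 1 -> w 0 = 0 ->
  (forall t, 1 <= t -> w t = Rpower t p) ->
  exists r, lower_set (2 * S m) (Gamma2_integrand beta m w) r /\ 0 < r.
Proof.
  intros Hb Hp Hp1 H0 Hbig. assert (Hc := c_const_pos beta (S m) Hb).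
  destruct (second_diff_power p Hp Hp1) as [e [He Hsd]].
  set (c := c_const beta (S m)) in *. set (a := INR (S m) + beta).
  assert (Ha : 0 <= a) by (assert (H := pos_INR (S m)); unfold a; lra).
  set (N := sqrt (INR (S m)) * 2).
  assert (HN : 1 <= N).
  { apply Rle_trans with (1 * 2); [lra|]. apply Rmult_le_compat_r; [lra|].
    rewrite <- sqrt_1. apply sqrt_le_1_alt. apply (le_INR 1); lia. }
  set (r0 := c ^ 2 * e * / Rpower N a * / Rpower N a).
  assert (Hr0 : 0 < r0).
  { assert (0 < c ^ 2) by now apply pow_lt.
    assert (0 < / Rpower N a) by apply Rinv_0_lt_compat, Rpower_pos.
    do 3 (apply Rmult_lt_0_compat; auto). }
  exists r0. split; auto.
  exists ((r0, (fun _ => 1, fun _ => 2)) :: nil). split; [|split].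
  - constructor; [|constructor]. simpl. split; [lra|intros; lra].
  - intros x. cbn [step_val fold_right fst snd]. rewrite Rplus_0_l.
    destruct (box_ind_cases (2 * S m) (fun _ => 1) (fun _ => 2) x) as [->|[-> Hx]].
    { rewrite Rmult_0_r. apply Gamma2_integrand_nonneg. }
    rewrite Rmult_1_r. unfold Gamma2_integrand, r0. fold c a.
    assert (Hnorm : forall y : nat -> R, (forall i, (i < S m)%nat -> 1 <= y i <= 2) ->
      / Rpower N a <= / apow (normd (S m) y) a).
    { intros y Hy. assert (Hy0 := Hy O ltac:(lia)).
      assert (1 <= normd (S m) y).
      { apply Rle_trans with (Rabs (y O)); [rewrite Rabs_pos_eq; lra|apply Rabs_le_normd; lia]. }
      rewrite apow_pos_eq by lra. apply Rinv_le_contravar; [apply Rpower_pos|].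
      apply Rpower_le_base; auto. split; [lra|].
      apply normd_le_sup; [lra|]. intros i Hi. specialize (Hy i Hi). rewrite Rabs_pos_eq; lra. }
    assert (Hi0 : 0 <= / Rpower N a) by (left; apply Rinv_0_lt_compat, Rpower_pos).
    assert (Hc2 := pow2_ge_0 c).
    apply Rmult_le_compat; auto.
    + apply Rmult_le_pos; auto. apply Rmult_le_pos; lra.
    + apply Rmult_le_compat; auto.
      * apply Rmult_le_pos; lra.
      * apply Rmult_le_compat_l; auto. unfold second_diff.
        assert (Hx0 := Hx O ltac:(lia)). assert (Hx1 := Hx (S m) ltac:(lia)).
        rewrite !Hbig, H0, Rplus_0_r by lra. now apply Hsd.
      * apply Hnorm. intros i Hi. apply Hx. lia.
    + apply Hnorm. intros i Hi. apply Hx. lia.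
  - cbn [step_int fold_right fst snd]. unfold box_vol. rewrite prodd_const.
    replace (2 - 1) with 1 by ring. rewrite pow1. ring.
Qed.

(** * An explicit family of profiles *)

Definition glue (f1 f2 : R -> R) (x : R) : R := if Rlt_dec x 1 then f1 x else f2 x.

Lemma derivable_glue f1 f2 f1' f2' x :
  (forall t, t <= 1 -> derivable_pt_lim f1 t (f1' t)) ->
  (forall t, 1 <= t -> derivable_pt_lim f2 t (f2' t)) ->
  f1 1 = f2 1 -> f1' 1 = f2' 1 ->
  derivable_pt_lim (glue f1 f2) x (glue f1' f2' x).
Proof.
  intros H1 H2 E E' e He. unfold glue.
  destruct (Rtotal_order x 1) as [Hx|[->|Hx]].
  - destruct (H1 x ltac:(lra) e He) as [dl H].
    assert (Hm : 0 < Rmin dl (1 - x)) by (apply Rmin_glb_lt; [apply cond_pos|lra]).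
    exists (mkposreal _ Hm). simpl. intros h Hh Hl.
    assert (Rabs h < dl) by (eapply Rlt_le_trans; [exact Hl|apply Rmin_l]).
    assert (Rabs h < 1 - x) by (eapply Rlt_le_trans; [exact Hl|apply Rmin_r]).
    assert (x + h < 1) by (assert (h <= Rabs h) by apply Rle_abs; lra).
    repeat (destruct Rlt_dec; try lra). auto.
  - destruct (H1 1 ltac:(lra) e He) as [d1 G1]. destruct (H2 1 ltac:(lra) e He) as [d2 G2].
    assert (Hm : 0 < Rmin d1 d2) by (apply Rmin_glb_lt; apply cond_pos).
    exists (mkposreal _ Hm). simpl. intros h Hh Hl.
    assert (Rabs h < d1) by (eapply Rlt_le_trans; [exact Hl|apply Rmin_l]).
    assert (Rabs h < d2) by (eapply Rlt_le_trans; [exact Hl|apply Rmin_r]).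
    destruct (Rlt_dec 1 1); [lra|]. destruct Rlt_dec; auto.
    rewrite <- E, <- E'. auto.
  - destruct (H2 x ltac:(lra) e He) as [dl H].
    assert (Hm : 0 < Rmin dl (x - 1)) by (apply Rmin_glb_lt; [apply cond_pos|lra]).
    exists (mkposreal _ Hm). simpl. intros h Hh Hl.
    assert (Rabs h < dl) by (eapply Rlt_le_trans; [exact Hl|apply Rmin_l]).
    assert (Rabs h < x - 1) by (eapply Rlt_le_trans; [exact Hl|apply Rmin_r]).
    assert (1 < x + h).
    { assert (- h <= Rabs h) by (rewrite <- Rabs_Ropp; apply Rle_abs). lra. }
    repeat (destruct Rlt_dec; try lra). auto.
Qed.

Lemma continuity_glue f1 f2 :
  continuity f1 -> (forall t, 1 <= t -> continuity_pt f2 t) -> f1 1 = f2 1 ->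
  continuity (glue f1 f2).
Proof.
  intros H1 H2 E x.
  destruct (Rlt_dec x 1) as [Hx|Hx].
  - apply (continuity_pt_locally_ext f1 _ (1 - x)); [lra| |apply H1].
    intros y Hy. unfold glue. destruct Rlt_dec; auto.
    unfold Rdist in Hy. assert (y - x <= Rabs (y - x)) by apply Rle_abs. lra.
  - intros e He. destruct (H1 x e He) as [d1 [Hd1 G1]].
    destruct (H2 x ltac:(lra) e He) as [d2 [Hd2 G2]].
    destruct (Req_dec x 1) as [->|Hx1].
    + exists (Rmin d1 d2). split; [now apply Rmin_glb_lt|]. intros y [Hy Hd].
      assert (dist R_met y 1 < d1) by (eapply Rlt_le_trans; [exact Hd|apply Rmin_l]).
      assert (dist R_met y 1 < d2) by (eapply Rlt_le_trans; [exact Hd|apply Rmin_r]).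
      unfold glue. destruct (Rlt_dec 1 1); [lra|]. destruct Rlt_dec; [rewrite <- E|]; auto.
    + exists (Rmin d2 (x - 1)). split; [apply Rmin_glb_lt; lra|]. intros y [Hy Hd].
      assert (dist R_met y x < d2) by (eapply Rlt_le_trans; [exact Hd|apply Rmin_l]).
      assert (Hd3 : dist R_met y x < x - 1) by (eapply Rlt_le_trans; [exact Hd|apply Rmin_r]).
      simpl in Hd3. unfold Rdist in Hd3. rewrite Rabs_minus_sym in Hd3.
      assert (x - y <= Rabs (x - y)) by apply Rle_abs.
      unfold glue. destruct Rlt_dec; [lra|]. destruct Rlt_dec; [lra|]. auto.
Qed.

(* The profile is [model_sq p (x * x)], so that evenness is free and the pieces meet only at [x * x = 1]. *)
Definition model_sq (p : R) : R -> R :=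
  glue (fun s => ((4 - p) * s - (2 - p) * (s * s)) / 2) (fun s => Rpower s (p / 2)).
Definition model_sq' (p : R) : R -> R :=
  glue (fun s => (4 - p) / 2 - (2 - p) * s) (fun s => p / 2 * Rpower s (p / 2 - 1)).

(** The quadratic piece has no constant term, and its two coefficients are those giving value 1 and
    slope [p / 2] at [s = 1], like [s^(p/2)]. *)
Lemma derivable_model_sq p s : derivable_pt_lim (model_sq p) s (model_sq' p s).
Proof.
  apply derivable_glue.
  - intros t _.
    assert (H : derivable_pt_lim (fun s => (4 - p) / 2 * s - (2 - p) / 2 * (s * s)) t
                 ((4 - p) / 2 * 1 - (2 - p) / 2 * (1 * t + t * 1))).
    { apply (derivable_pt_lim_minus (fun s => (4 - p) / 2 * s) (fun s => (2 - p) / 2 * (s * s))).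
      - apply (derivable_pt_lim_scal id), derivable_pt_lim_id.
      - apply (derivable_pt_lim_scal (fun s => s * s)).
        apply (derivable_pt_lim_mult id id); apply derivable_pt_lim_id. }
    replace ((4 - p) / 2 - (2 - p) * t) with
      ((4 - p) / 2 * 1 - (2 - p) / 2 * (1 * t + t * 1)) by field.
    intros e He. destruct (H e He) as [dl Hd]. exists dl. intros h Hh Hl.
    specialize (Hd h Hh Hl).
    replace (((4 - p) * (t + h) - (2 - p) * ((t + h) * (t + h))) / 2)
      with ((4 - p) / 2 * (t + h) - (2 - p) / 2 * ((t + h) * (t + h))) by field.
    replace (((4 - p) * t - (2 - p) * (t * t)) / 2)
      with ((4 - p) / 2 * t - (2 - p) / 2 * (t * t)) by field. auto.
  - intros t Ht. apply derivable_pt_lim_power. lra.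
  - rewrite Rpower_1_l. field.
  - rewrite Rpower_1_l. field.
Qed.

Lemma continuity_model_sq' p : continuity (model_sq' p).
Proof.
  apply continuity_glue.
  - intros t. apply derivable_continuous_pt.
    exists (0 - (2 - p) * 1).
    apply (derivable_pt_lim_minus (fun _ => (4 - p) / 2) (fun s => (2 - p) * s)).
    + apply derivable_pt_lim_const.
    + apply (derivable_pt_lim_scal id), derivable_pt_lim_id.
  - intros t Ht. apply derivable_continuous_pt.
    exists (p / 2 * ((p / 2 - 1) * Rpower t (p / 2 - 1 - 1))).
    apply (derivable_pt_lim_scal (fun s => Rpower s (p / 2 - 1))), derivable_pt_lim_power. lra.
  - rewrite Rpower_1_l. field.
Qed.

Definition model (p x : R) : R := model_sq p (x * x).

Lemma Rabs_ge_1_sq x : 1 <= Rabs x <-> 1 <= x * x.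
Proof.
  replace (x * x) with (Rabs x * Rabs x) by (rewrite <- Rabs_mult; apply Rabs_pos_eq, Rle_0_sqr).
  assert (H := Rabs_pos x). split; intros; nra.
Qed.

(** Near 0 the model is quadratic in [x], whence [delta = 2 - beta], which does not depend on [eps].
    The constant 8 comes from the derivative: the slope in [x * x] is at most 4, and the chain rule
    adds [2 |x|]. *)
Lemma model_profile beta eps : 0 < beta < 2 -> 0 < eps < beta ->
  u_profile beta 8 (2 - beta) eps (model (beta - eps)).
Proof.
  intros Hb He. set (p := beta - eps). assert (Hp : 0 < p < 2) by (unfold p; lra).
  assert (Hsq : forall x, Rabs x < 1 -> 0 <= x * x < 1).
  { intros x Hx. split; [apply Rle_0_sqr|]. apply Rnot_le_lt. rewrite <- Rabs_ge_1_sq. lra. }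
  split; [|split; [|split]].
  - exists (fun x => model_sq' p (x * x) * (1 * x + x * 1)). split; [|split].
    + intros x. apply (derivable_pt_lim_comp (fun x => x * x) (model_sq p)).
      * apply (derivable_pt_lim_mult id id); apply derivable_pt_lim_id.
      * apply derivable_model_sq.
    + intros x. apply (continuity_pt_mult (fun x => model_sq' p (x * x))).
      * apply (continuity_pt_comp (fun x => x * x)); [|apply continuity_model_sq'].
        apply (continuity_pt_mult id id); apply derivable_continuous_pt, derivable_pt_id.
      * apply (continuity_pt_plus (fun x => 1 * x) (fun x => x * 1)).
        -- apply (continuity_pt_mult (fun _ => 1) id);
             apply derivable_continuous_pt; [apply derivable_pt_const|apply derivable_pt_id].
        -- apply (continuity_pt_mult id (fun _ => 1));
             apply derivable_continuous_pt; [apply derivable_pt_id|apply derivable_pt_const].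
    + intros x Hx. assert (Hs := Hsq x Hx).
      replace (beta + (2 - beta) - 1) with 1 by ring.
      unfold model_sq', glue. destruct Rlt_dec; [|lra].
      rewrite Rabs_mult. replace (1 * x + x * 1) with (2 * x) by ring.
      rewrite Rabs_mult, (Rabs_pos_eq 2) by lra.
      assert (E : apow x 1 = Rabs x).
      { unfold apow. destruct Req_EM_T as [->|Hx0]; [now rewrite Rabs_R0|].
        now rewrite Rpower_1 by now apply Rabs_pos_lt. }
      rewrite E. assert (Rabs ((4 - p) / 2 - (2 - p) * (x * x)) <= 4).
      { apply Rabs_le. nra. }
      assert (H0 := Rabs_pos x). nra.
  - intros x. unfold model. f_equal. ring.
  - intros x Hx. unfold model, model_sq, glue.
    assert (H := proj1 (Rabs_ge_1_sq x) Hx). destruct Rlt_dec; [lra|].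
    unfold apow. destruct Req_EM_T as [->|Hx0]; [rewrite Rabs_R0 in Hx; lra|].
    replace (x * x) with (Rabs x ^ 2) by (rewrite pow2_abs; ring).
    rewrite <- Rpower_pow, Rpower_mult by lra. f_equal. unfold p. simpl. field.
  - intros x Hx. assert (Hs := Hsq x Hx).
    replace (beta + (2 - beta)) with 2 by ring.
    assert (E : apow x 2 = x * x).
    { unfold apow. destruct Req_EM_T as [->|Hx0]; [ring|].
      replace 2 with (INR 2) by (simpl; ring).
      rewrite Rpower_pow by now apply Rabs_pos_lt. rewrite pow2_abs. ring. }
    rewrite E. unfold model, model_sq, glue. destruct Rlt_dec; [|lra].
    set (s := x * x) in *. clearbody s. nra.
Qed.

(** * Choice of the exponents and conclusion *)

Lemma blow_up_bounds beta m Lam delta (u : R -> R -> R) :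
  0 < beta < 2 -> (1 <= m)%nat -> 0 < Lam -> 0 < delta -> 1 < beta + delta ->
  (forall eps, admissible beta eps -> u_profile beta Lam delta eps (u eps)) ->
  exists C2 C3 eps0, 0 < C2 /\ 0 < C3 /\ 0 < eps0 /\
    forall eps, 0 < eps < eps0 -> admissible beta eps ->
      (exists Lv, L_is beta (S m) (fun x => u eps (x O)) vzero Lv /\ C2 / eps <= Lv) /\
      (exists G, Gamma2_is beta (S m) (fun x => u eps (x O)) vzero G /\ 0 < G <= C3 / eps).
Proof.
  intros Hb Hm HL Hdl Hbd Hu. assert (Hc := c_const_pos beta (S m) Hb).
  assert (Hs : exists s, beta / 2 < s /\ s <= 1 /\ s < beta).
  (* The increment [beta (2 - beta) / 8] is positive, below [beta / 2], and below [1 - beta / 2]. *)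
  { exists (beta / 2 + beta * (2 - beta) / 8). repeat split; nra. }
  destruct Hs as [s [Hs1 [Hs2 Hs3]]].
  set (kap := s - beta / 2).
  (* With [q = beta + dl], the condition [kap <= beta + 2 s - 2 q] reads [kap <= 2 kap - 2 dl];
     hence [dl <= kap / 2]. *)
  assert (Hdl' : exists dl, 0 < dl /\ dl <= delta /\ dl <= kap / 2).
  { exists (Rmin delta (kap / 2)). split; [|split; [apply Rmin_l|apply Rmin_r]].
    apply Rmin_glb_lt; unfold kap; lra. }
  destruct Hdl' as [dl [Hd1 [Hd2 Hd3]]].
  set (A := (c_const beta (S m) * (2 * (1 + / ((1 + beta) / INR m))) ^ m) ^ 2 *
            (4 * (35 * (Lam + 2)) ^ 2 / kap)).
  assert (HA : 0 < A).
  { assert (0 < INR m) by (apply lt_0_INR; lia).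
    unfold A. apply Rmult_lt_0_compat.
    - apply pow_lt, Rmult_lt_0_compat; auto. apply pow_lt.
      assert (0 < / ((1 + beta) / INR m)); [|lra].
      apply Rinv_0_lt_compat, Rdiv_lt_0_compat; lra.
    - apply Rdiv_lt_0_compat; [|unfold kap; lra]. apply Rmult_lt_0_compat; [lra|].
      apply pow_lt; lra. }
  exists (c_const beta (S m) * / Rpower (2 * sqrt (INR (S m))) (INR (S m) + beta) * (1 / 2) ^ S m).
  (* The bound for [Gamma_2] is [A / dl + A / eps], which is at most [A (1 / dl + 1) / eps] because
     [eps < beta / 2 < 1]. The threshold [beta - s] ensures [s <= beta - eps]. *)
  exists (A * (/ dl + 1)), (beta - s).
  assert (Hdli : 0 < / dl) by now apply Rinv_0_lt_compat.
  split; [|split; [|split; [lra|]]].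
  { apply Rmult_lt_0_compat; [|apply pow_lt; lra].
    apply Rmult_lt_0_compat; auto. apply Rinv_0_lt_compat, Rpower_pos. }
  { apply Rmult_lt_0_compat; lra. }
  intros eps Heps Hadm. assert (Hprof := Hu eps Hadm).
  destruct Hadm as [He Hadm]. set (w := u eps) in *.
  destruct (profile_facts beta Lam delta eps w) as [H0 [Hpos [w' [Hder Hgr]]]]; auto; [lra|].
  destruct Hprof as [_ [Heven [Hbig _]]].
  assert (Hbig' : forall t, 1 <= t -> w t = Rpower t (beta - eps)).
  { intros t Ht. rewrite Hbig by (rewrite Rabs_pos_eq; lra). apply apow_pos_eq. lra. }
  split.
  - destruct (L_lint beta m w (Lam + 2) (beta - eps) (beta + dl)) as [C HC]; auto; try lra.
    { intros t Ht. split; apply Hgr; auto; lra. }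
    destruct (integral_exists _ _ _ HC) as [I [HI [HnI _]]].
    { intros; now apply L_integrand_nonneg. }
    exists I. split; [now apply L_is_first_coord|].
    destruct (L_lower beta m w eps) as [r [Hr Hr']]; auto; [lra|].
    eapply Rle_trans; [exact Hr'|]. now apply HnI.
  - assert (HC := Gamma2_lint beta m w w' (Lam + 2) s (beta - eps) (beta + dl) kap).
    cbv zeta in HC. fold A in HC.
    destruct (integral_exists _ _ _ (HC Hm Hb ltac:(lra) ltac:(lra) ltac:(lra)
      ltac:(unfold kap in *; lra) ltac:(unfold kap; lra) ltac:(unfold kap; lra)
      ltac:(unfold kap in *; lra) H0 Hder
      ltac:(intros r Hr; apply Hgr; lra))) as [G [HG [HnG HGC]]].
    { intros; apply Gamma2_integrand_nonneg. }
    exists G. split; [now apply Gamma2_is_first_coord|]. split.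
    (* Here [beta - eps <> 1]: it is below 1 when [beta <= 1], and above [(beta + 1) / 2] when
       [beta > 1]. *)
    + destruct (Gamma2_lower beta m w (beta - eps)) as [r [Hr Hr']]; auto; try lra.
      apply Rlt_le_trans with r; auto. now apply HnG.
    + eapply Rle_trans; [exact HGC|].
      replace (beta + dl - beta) with dl by ring.
      replace (beta - (beta - eps)) with eps by ring.
      replace (2 * (A / (2 * dl) + A / (2 * eps))) with (A * (/ dl * eps + 1) / eps)
        by (field; lra).
      unfold Rdiv. apply Rmult_le_compat_r; [left; apply Rinv_0_lt_compat; lra|].
      apply Rmult_le_compat_l; [lra|]. apply Rplus_le_compat_r.
      rewrite <- (Rmult_1_r (/ dl)) at 2. apply Rmult_le_compat_l; lra.
Qed.

Theorem theorem3p2 (beta : R) (d : nat) :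
  0 < beta < 2 -> (2 <= d)%nat ->
  (forall (Lam delta : R) (u : R -> R -> R),
     0 < Lam -> 0 < delta -> 1 < beta + delta ->
     (forall eps, admissible beta eps -> u_profile beta Lam delta eps (u eps)) ->
     exists C2 C3 eps0, 0 < C2 /\ 0 < C3 /\ 0 < eps0 /\
       forall eps, 0 < eps < eps0 -> admissible beta eps ->
         (exists Lv, L_is beta d (fun x => u eps (x O)) vzero Lv /\ C2 / eps <= Lv) /\
         (exists G, Gamma2_is beta d (fun x => u eps (x O)) vzero G /\
                    0 < G <= C3 / eps)) /\
  (forall mu, 0 < mu ->
     exists v : (nat -> R) -> R,
       depends_on_first d v /\ cont_Rd d v /\
       exists Lv G, L_is beta d v vzero Lv /\ Gamma2_is beta d v vzero G /\
                    0 < G < mu * Lv ^ 2).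
Proof.
  intros Hb Hd. destruct d as [|m]; [lia|]. assert (Hm : (1 <= m)%nat) by lia.
  split; [intros; now apply blow_up_bounds with Lam delta|].
  intros mu Hmu.
  assert (Hmodel : forall eps, admissible beta eps ->
    u_profile beta 8 (2 - beta) eps (model (beta - eps))).
  { intros eps [He _]. apply model_profile; lra. }
  destruct (blow_up_bounds beta m 8 (2 - beta) (fun eps => model (beta - eps)))
    as [C2 [C3 [eps0 [HC2 [HC3 [He0 H]]]]]]; auto; try lra.
  (* [C3 / eps] drops below [mu (C2 / eps)^2] exactly when [eps < mu C2^2 / C3]. *)
  assert (Heps : exists eps, 0 < eps < eps0 /\ admissible beta eps /\ eps < mu * C2 ^ 2 / C3).
  { set (a := if Rlt_dec 1 beta then (beta - 1) / 2 else 1).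
    assert (Ha : 0 < a) by (unfold a; destruct Rlt_dec; lra).
    set (b := mu * C2 ^ 2 / C3).
    assert (Hb' : 0 < b).
    { apply Rdiv_lt_0_compat; auto. apply Rmult_lt_0_compat; auto. now apply pow_lt. }
    set (e := Rmin (Rmin eps0 (beta / 2)) (Rmin a b)).
    assert (0 < e) by (repeat apply Rmin_glb_lt; lra).
    assert (e <= eps0 /\ e <= beta / 2 /\ e <= a /\ e <= b) as [E1 [E2 [E3 E4]]].
    { unfold e. repeat split.
      - eapply Rle_trans; [apply Rmin_l|apply Rmin_l].
      - eapply Rle_trans; [apply Rmin_l|apply Rmin_r].
      - eapply Rle_trans; [apply Rmin_r|apply Rmin_l].
      - eapply Rle_trans; [apply Rmin_r|apply Rmin_r]. }
    exists (e / 2). split; [lra|]. split; [split; [lra|]|fold b; lra].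
    intros Hb1. unfold a in E3. destruct Rlt_dec; lra. }
  destruct Heps as [eps [He [Hadm Hsmall]]].
  destruct (H eps He Hadm) as [[Lv [HLv HLv']] [G [HG [HG0 HG1]]]].
  exists (fun x => model (beta - eps) (x O)). split; [|split].
  - intros x y Hxy. now rewrite (Hxy O) by lia.
  - intros x e Hpos. destruct (Hmodel eps Hadm) as [[w' [Hder _]] _].
    assert (Hcont : continuity_pt (model (beta - eps)) (x O)).
    { apply derivable_continuous_pt. exists (w' (x O)). apply Hder. }
    destruct (Hcont e Hpos) as [dl [Hdl Hc]]. exists dl. split; auto.
    (* [continuity_pt] speaks only of points other than the base point, so equal first coordinates
       are treated apart. *)
    intros y Hy. destruct (Req_dec (x O) (y O)) as [->|Hne].
    + unfold Rminus. rewrite Rplus_opp_r, Rabs_R0. auto.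
    + apply Hc. split; [split; [exact I|auto]|].
      eapply Rle_lt_trans; [|exact Hy]. apply (Rabs_le_normd (S m) (vsub y x) O). lia.
  - exists Lv, G. split; [auto|split; [auto|split; [auto|]]].
    eapply Rle_lt_trans; [exact HG1|].
    apply Rlt_le_trans with (mu * (C2 / eps) ^ 2).
    + apply Rmult_lt_reg_r with (eps ^ 2); [apply pow_lt; lra|].
      replace (C3 / eps * eps ^ 2) with (C3 * eps) by (field; lra).
      replace (mu * (C2 / eps) ^ 2 * eps ^ 2) with (C3 * (mu * C2 ^ 2 / C3)) by (field; lra).
      apply Rmult_lt_compat_l; auto.
    + apply Rmult_le_compat_l; [lra|]. apply pow_incr. split; auto.
      left; apply Rdiv_lt_0_compat; lra.
Qed.
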